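(* Let $P$ be a pure brush polyomino, let $G=G_P$, let $K$ be a field, let $R$ be the polynomial ring over $K$ whose variables are indexed by the cells of $P$, and let $I(G)\subset R$ be the edge ideal of $G$. Then $\operatorname{reg} R/I(G)=\nu(G)$, where $\nu(G)$ is the induced matching number of $G$.
   Context: A cell is a unit square $[a,a+(1,1)]$ with $a\in\mathbb{Z}^2$; it is identified with its lower left corner $a$. Two cells are adjacent if they share an edge. A polyomino $P$ is a nonempty finite set of cells such that any two cells of $P$ are joined by a sequence of cells of $P$ in which consecutive cells are adjacent. $P$ is simple (has no hole) if any two cells of the grid not belonging to $P$ are joined by a sequence of cells not belonging to $P$ in which consecutive cells are adjacent. $P$ is thin if it does not contain a $2\times 2$ square of cells. A cell interval of $P$ is a set of at least two consecutive cells of $P$ in one row or in one column of the grid; $\mathcal{C}$ denotes the set of all cell intervals of $P$ that are maximal with respect to inclusion, and $|I|$ is the number of cells of $I$. Two distinct cells of $P$ are attacking if some element of $\mathcal{C}$ contains both. The rook complex $\mathcal{R}$ of $P$ is the simplicial complex whose faces are the sets of pairwise non-attacking cells of $P$; it is pure if all its facets have the same dimension. $G_P$ is the graph whose vertices are the cells of $P$ and whose edges are the attacking pairs. A brush polyomino is a simple thin polyomino $P$ such that $\mathcal{C}=\{J,I_1,\dots,I_l\}$ with $0\le l\le |J|$ and $I_k\cap J\neq\varnothing$ (a common cell) for every $k\in\{1,\dots,l\}$. A pure brush polyomino is a brush polyomino whose rook complex $\mathcal{R}$ is pure. The edge ideal $I(G)$ is generated by the monomials $x_ux_v$ with $\{u,v\}\in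 E(G)$. $\operatorname{reg} R/I(G)=\max\{j-i:\beta_{i,j}\neq0\}$, where $\beta_{i,j}$ are the graded Betti numbers of the minimal graded free resolution of $R/I(G)$ over $R$. An induced matching of $G$ is a set of pairwise disjoint edges such that the graph having these edges as edge set is an induced subgraph of $G$; $\nu(G)$ is the maximum size of an induced matching of $G$. *)

(* Defs.v *)
From mathcomp Require Import all_boot all_order all_algebra.
From mathcomp Require Import finmap.
From mathcomp Require Import mpoly.

Set Implicit Arguments.
Unset Strict Implicit.
Unset Printing Implicit Defensive.

Import Order.TTheory GRing.Theory Num.Theory.

(* MathComp, with finmap for finite sets of cells and multinomials for
   the polynomial ring. *)

(** * Polyominoes *)

(* The unit square [a, a + (1,1)] is represented by its lower left corner. *)
Notation cell := (int * int)%type.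

Definition adjacent : rel cell :=
  fun a b => (`|a.1 - b.1| + `|a.2 - b.2| == 1)%R.

Definition cell_connected (S : pred cell) : Prop :=
  forall a b : cell, S a -> S b ->
    exists s : seq cell, [/\ path adjacent a s, all S s & last a s = b].

Definition polyomino (P : {fset cell}) : Prop :=
  P != fset0 /\ cell_connected (fun a => a \in P).

Definition simple_polyomino (P : {fset cell}) : Prop :=
  cell_connected (fun a => a \notin P).

Definition thin (P : {fset cell}) : Prop :=
  forall x y : int,
    ~~ [&& (x, y) \in P, (x + 1, y)%R \in P,
           (x, y + 1)%R \in P & (x + 1, y + 1)%R \in P].

(* The k consecutive cells starting at a, rightwards or upwards. *)
Definition row_run (a : cell) (k : nat) : {fset cell} :=
  [fset (a.1 + t%:Z, a.2)%R | t in iota 0 k]%fset.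
Definition col_run (a : cell) (k : nat) : {fset cell} :=
  [fset (a.1, a.2 + t%:Z)%R | t in iota 0 k]%fset.

Definition cell_interval (P I : {fset cell}) : bool :=
  [&& (I `<=` P)%fset, 2 <= #|` I| &
      [exists a : P, (I == row_run (val a) #|` I|)
                     || (I == col_run (val a) #|` I|)]].

Definition max_cell_intervals (P : {fset cell}) : {fset {fset cell}} :=
  [fset I in fpowerset P |
     cell_interval P I &&
     all (fun J => cell_interval P J && (I `<=` J)%fset ==> (J == I))
         (fpowerset P)]%fset.

(* The edge relation of the graph G_P, whose vertices are the cells of P. *)
Definition attacking (P : {fset cell}) : rel P :=
  fun u v => (u != v) &&
    has (fun I : {fset cell} => (val u \in I) && (val v \in I))
        (max_cell_intervals P).
Arguments attacking P : clear implicits.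

Definition brush (P : {fset cell}) : Prop :=
  [/\ polyomino P, simple_polyomino P, thin P &
      exists (J : {fset cell}) (Is : seq {fset cell}),
        [/\ uniq (J :: Is),
            max_cell_intervals P = [fset I in J :: Is]%fset,
            size Is <= #|` J| &
            forall I, I \in Is -> (I `&` J != fset0)%fset]].

(** * Simplicial complexes, given by their set of faces *)

Definition facet (T : finType) (D : {set {set T}}) (A : {set T}) : bool :=
  maxset (fun B => B \in D) A.

Definition face_dim (T : finType) (A : {set T}) : int := (#|A|%:Z - 1)%R.

Definition pure_complex (T : finType) (D : {set {set T}}) : Prop :=
  forall A B : {set T}, facet D A -> facet D B -> face_dim A = face_dim B.

Definition rook_complex (P : {fset cell}) : {set {set P}} :=
  [set A : {set P} | [forall u in A, forall v in A, ~~ attacking P u v]].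

Definition pure_brush (P : {fset cell}) : Prop :=
  brush P /\ pure_complex (rook_complex P).

(** * Simple graphs, given by a symmetric irreflexive relation *)

Definition edges (V : finType) (e : rel V) : {set {set V}} :=
  [set [set p.1; p.2] | p : V * V & e p.1 p.2].

Definition induced_matching (V : finType) (e : rel V) (M : {set {set V}})
    : bool :=
  [&& M \subset edges e, trivIset M &
      [forall A in edges e, (A \subset cover M) ==> (A \in M)]].

Definition induced_matching_number (V : finType) (e : rel V) : nat :=
  \max_(M : {set {set V}} | induced_matching e M) #|M|.

Local Open Scope ring_scope.

(* The variable attached to the vertex v is 'X_(enum_rank v). *)
Definition edge_ideal (K : fieldType) (V : finType) (e : rel V)
    (p : {mpoly K[#|V|]}) : Prop :=
  exists c : V -> V -> {mpoly K[#|V|]},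
    p = \sum_u \sum_(v | e u v) c u v * ('X_(enum_rank u) * 'X_(enum_rank v)).
Arguments edge_ideal K {V} e p.

(** * Minimal graded free resolutions of R/I, for R = {mpoly K[n]} *)

(* The data of F_0 <- F_1 <- F_2 <- ... together with a lift F_0 -> R of the
   augmentation F_0 -> R/I.  F_i is the module of row vectors of length
   fr_rank i, whose k-th basis vector has degree fr_shift k, and the maps are
   right multiplications.  Natural numbers suffice as shifts: a nonzero
   element of R/I has no homogeneous component of negative degree, so
   neither do the terms of a minimal resolution of R/I. *)
Record free_complex (K : fieldType) (n : nat) := FreeComplex {
  fr_rank : nat -> nat;
  fr_shift : forall i, 'I_(fr_rank i) -> nat;
  fr_aug : 'cV[{mpoly K[n]}]_(fr_rank 0%N);
  fr_diff : forall i, 'M[{mpoly K[n]}]_(fr_rank i.+1, fr_rank i) }.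

Section Resolution.

Variables (K : fieldType) (n : nat).
Implicit Types (I : {mpoly K[n]} -> Prop) (F : free_complex K n).

(* All maps preserve degrees. *)
Definition graded_complex F : Prop :=
  (forall k, fr_aug F k 0 \is (fr_shift k).-homog) /\
  (forall i (r : 'I_(fr_rank F i.+1)) (k : 'I_(fr_rank F i)),
     fr_diff F i r k != 0 ->
     exists2 d : nat, fr_shift r = (fr_shift k + d)%N
                    & fr_diff F i r k \is d.-homog).

(* Exactness of ... -> F_1 -> F_0 -> R/I -> 0. *)
Definition resolves F I : Prop :=
  [/\ forall p : {mpoly K[n]},
        exists v : 'rV_(fr_rank F 0%N), I (p - (v *m fr_aug F) 0 0),
      forall v : 'rV_(fr_rank F 0%N),
        I ((v *m fr_aug F) 0 0) <-> exists w, v = w *m fr_diff F 0%N &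
      forall i (v : 'rV_(fr_rank F i.+1)),
        v *m fr_diff F i = 0 <-> exists w, v = w *m fr_diff F i.+1].

(* The image of F_(i+1) lies in (x_1, ..., x_n) F_i. *)
Definition minimal_complex F : Prop :=
  forall i r k, (fr_diff F i r k)@_0%MM = 0.

Definition minimal_graded_free_resolution F I : Prop :=
  [/\ graded_complex F, resolves F I & minimal_complex F].

Definition betti F (i j : nat) : nat :=
  #|[set k : 'I_(fr_rank F i) | fr_shift k == j]|.

(* r = max { j - i : beta_(i,j) <> 0 } *)
Definition max_betti_slope F (r : int) : Prop :=
  (exists i j : nat, betti F i j != 0%N /\ j%:Z - i%:Z = r) /\
  (forall i j : nat, betti F i j != 0%N -> j%:Z - i%:Z <= r).

(* reg R/I = r.  Minimal graded free resolutions are unique only up to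
   isomorphism, so the value is required on all of them; the first clause
   excludes the vacuous case. *)
Definition regularity_quotient_is I (r : int) : Prop :=
  (exists F, minimal_graded_free_resolution F I) /\
  (forall F, minimal_graded_free_resolution F I -> max_betti_slope F r).

End Resolution.

(* Main.v *)
Require Import Defs.
From HB Require Import structures.
From mathcomp Require Import all_boot all_order all_algebra.
From mathcomp Require Import finmap.
From mathcomp Require Import mpoly.
From mathcomp Require Import zify ring.
From Stdlib Require Import Classical IndefiniteDescription.

(* The graph of a brush polyomino is chordal: a cell outside [J] lies in a single
   maximal interval, so listing the cells outside [J] before those of [J] is a
   perfect elimination order.

   Let [G] be a graph with such an order, [x] its first non-isolated vertex and
   [v] a neighbour of [x], so that [N[x]] is a clique.  The colon ideal
   [I(G - xv) : x v] is generated by variables and [I(G - N[v])], and a mapping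
   cone yields [reg G <= max (reg (G - xv), reg (G - N[v]) + 1)].  As [x] is
   simplicial, [nu (G - xv) <= nu G] and [nu (G - N[v]) + 1 <= nu G], whence
   [reg G <= nu G] by induction on the number of edges.

   Conversely, for an induced matching [M], the ideal [I(G)] lies between [I(M)]
   and [I(M)] plus the variables not covered by [M].  The outer ideals are
   generated by regular sequences, and modulo the variables the Koszul complex of
   the first is a direct summand of that of the second.  The comparison map
   between them factors through every resolution of [R/I(G)], which therefore has
   a generator of degree [2 |M|] in homological degree [|M|]. *)

Set Implicit Arguments.
Unset Strict Implicit.
Unset Printing Implicit Defensive.

Import Order.TTheory GRing.Theory Num.Theory.

Local Open Scope ring_scope.

(** * Graded free complexes *)

Section Graded.

Variables (K : fieldType) (n : nat).
Local Notation R := {mpoly K[n]}.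
Implicit Types (p q : R) (I : R -> Prop) (F G A B : free_complex K n).

Lemma mcoeff_pihomog d p m :
  (pihomog mdeg d p)@_m = if mdeg m == d then p@_m else 0.
Proof.
rewrite pihomogE raddf_sum /=.
under eq_bigr do rewrite mcoeffZ mcoeffX.
case: ifP => [md|md].
  have [mp|mp] := boolP (m \in msupp p).
    rewrite big_mkcond (bigD1_seq m) ?msupp_uniq //= md eqxx mulr1.
    by rewrite big1 ?addr0 // => i /negPf ->; rewrite mulr0 if_same.
  rewrite big1_seq ?(memN_msupp_eq0 mp) // => i /andP[_ ip].
  by case: (eqVneq i m) ip mp => [-> -> //|_ _ _]; rewrite mulr0.
rewrite big1_seq // => i /andP[id _].
by case: (eqVneq i m) id md => [-> -> //|_ _ _]; rewrite mulr0.
Qed.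

(* The component of degree [D] of [p], seen in a free module of rank one whose
   basis element has degree [t]. *)
Definition hpart (D t : nat) p : R :=
  if (t <= D)%N then pihomog mdeg (D - t) p else 0.

Lemma mcoeff_hpart D t p m :
  (hpart D t p)@_m = if (mdeg m + t == D)%N then p@_m else 0.
Proof.
rewrite /hpart; case: leqP => tD; rewrite ?mcoeff_pihomog ?mcoeff0.
  by congr (if _ then _ else _); lia.
by rewrite ifF //; lia.
Qed.

Fact hpart_linear D t : linear (hpart D t).
Proof.
move=> c p q; apply/mpolyP => m.
rewrite mcoeffD mcoeffZ !mcoeff_hpart mcoeffD mcoeffZ.
by case: ifP; rewrite // mulr0 addr0.
Qed.

HB.instance Definition _ D t :=
  GRing.isLinear.Build K R R *:%R (hpart D t) (hpart_linear D t).

Lemma hpart_homog D t d p :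
  p \is d.-homog -> hpart D t p = if (d + t == D)%N then p else 0.
Proof.
move=> /dhomogP hp; apply/mpolyP => m; rewrite mcoeff_hpart.
have [/hp <-|/memN_msupp_eq0 p0] := boolP (m \in msupp p).
  by case: ifP; rewrite ?mcoeff0.
by rewrite p0 !if_same; case: ifP; rewrite ?p0 ?mcoeff0.
Qed.

(** By linearity [p] may be taken to be a monomial, and then [p * q] is homogeneous. *)
Lemma hpartM D t e p q :
  q \is e.-homog -> hpart D t (p * q) = hpart D (t + e) p * q.
Proof.
move=> hq; rewrite (mpolyE p) big_distrl !raddf_sum big_distrl.
apply: eq_bigr => m _ /=.
have hX : ('X_[m] : R) \is (mdeg m).-homog by rewrite dhomogX.
rewrite -scalerAl !linearZ -scalerAl; congr (_ *: _) => /=.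
rewrite (hpart_homog _ _ (dhomogM hX hq)) (hpart_homog _ _ hX).
by rewrite -addnA [(e + t)%N]addnC; case: ifP; rewrite ?mul0r.
Qed.

(** Degree-preserving maps between graded free modules whose bases have degrees [s] and [t]. Zero
    entries are exempt, so [s i < t j] remains possible. *)
Definition hmx m k (s : 'I_m -> nat) (t : 'I_k -> nat) (M : 'M[R]_(m, k)) :=
  forall i j, M i j != 0 ->
    exists2 d : nat, s i = (t j + d)%N & M i j \is d.-homog.

Definition hrow k D (t : 'I_k -> nat) (v : 'rV[R]_k) : 'rV[R]_k :=
  \row_j hpart D (t j) (v 0 j).

Lemma hmxP m k (s : 'I_m -> nat) (t : 'I_k -> nat) (M : 'M[R]_(m, k)) :
  hmx s t M <-> forall i, hrow (s i) t (row i M) = row i M.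
Proof.
split=> [h i|h i j nz].
  apply/rowP => j; rewrite !mxE.
  have [->|/h[d -> hd]] := eqVneq (M i j) 0; first by rewrite linear0.
  by rewrite (hpart_homog _ _ hd) addnC eqxx.
have /rowP/(_ j) := h i; rewrite !mxE /hpart.
case: leqP => [le e|_ e]; last by rewrite -e eqxx in nz.
by exists (s i - t j)%N; [rewrite subnKC | rewrite -e pihomogP].
Qed.

(** Thanks to this, a preimage of a homogeneous vector can be replaced by its component of the right
    degree. *)
Lemma hrow_mul m k (s : 'I_m -> nat) (t : 'I_k -> nat) (M : 'M[R]_(m, k)) D v :
  hmx s t M -> hrow D t (v *m M) = hrow D s v *m M.
Proof.
move=> h; apply/rowP => j; rewrite !mxE raddf_sum; apply: eq_bigr => i _ /=.
rewrite mxE; have [->|/h[d -> hd]] := eqVneq (M i j) 0.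
  by rewrite !mulr0 linear0.
exact: hpartM.
Qed.

Lemma hmxM m k l (s : 'I_m -> nat) (t : 'I_k -> nat) (u : 'I_l -> nat)
    (M : 'M[R]_(m, k)) (N : 'M[R]_(k, l)) :
  hmx s t M -> hmx t u N -> hmx s u (M *m N).
Proof.
move=> /hmxP hM hN; apply/hmxP => i.
by rewrite row_mul (hrow_mul _ _ hN) hM.
Qed.

Lemma hrow_homog m k (s : 'I_m -> nat) (t : 'I_k -> nat) (v : 'I_m -> 'rV[R]_k) :
  hmx s t (\matrix_i hrow (s i) t (v i)).
Proof.
move=> i j; rewrite !mxE /hpart; case: leqP => [le _|_ /eqP//].
by exists (s i - t j)%N; [rewrite subnKC | rewrite pihomogP].
Qed.

(** * Homogeneous ideals and the cycles of an augmented complex *)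

Record graded_ideal I : Prop := GradedIdeal {
  gideal0 : I 0;
  gidealD : forall p q, I p -> I q -> I (p + q);
  gidealM : forall p q, I q -> I (p * q);
  gideal_homog : forall d p, I p -> I (pihomog mdeg d p) }.

Section Ideal.
Variables (I : R -> Prop) (hI : graded_ideal I).

Lemma gidealN p : I p -> I (- p).
Proof. by rewrite -mulN1r; exact: (gidealM hI). Qed.

Lemma gidealB p q : I p -> I q -> I (p - q).
Proof. by move=> Ip Iq; apply: (gidealD hI) => //; exact: gidealN. Qed.

Lemma gideal_sum (T : Type) (r : seq T) (P : pred T) (f : T -> R) :
  (forall i, P i -> I (f i)) -> I (\sum_(i <- r | P i) f i).
Proof.
move=> h; elim/big_ind: _ => //; first exact: gideal0.
exact: gidealD.
Qed.

End Ideal.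

(* The kernel of the map leaving [F_i]; for [i = 0] this map is the
   augmentation [F_0 -> R/I]. *)
Definition cycle F I i : 'rV[R]_(fr_rank F i) -> Prop :=
  match i with
  | 0%N => fun v => I ((v *m fr_aug F) 0 0)
  | i.+1 => fun v => v *m fr_diff F i = 0
  end.

Lemma cycle_boundary F I : resolves F I ->
  forall i (v : 'rV_(fr_rank F i)),
    cycle I v <-> exists w, v = w *m fr_diff F i.
Proof. by case=> _ h0 h [|i] v; [exact: h0 | exact: h]. Qed.

Section Degrees.
Variables (F : free_complex K n) (gF : graded_complex F).

Lemma hmx_aug : hmx (@fr_shift _ _ F 0) (fun _ => 0%N) (fr_aug F).
Proof.
move=> k j _; rewrite (ord1 j); exists (fr_shift k); first by [].
by case: gF => h _; apply: h.
Qed.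

Lemma hmx_diff i : hmx (@fr_shift _ _ F i.+1) (@fr_shift _ _ F i) (fr_diff F i).
Proof. by case: gF => _ h r k; apply: h. Qed.

End Degrees.

(** * Lifting matrices through the differentials of a resolution *)

Section Lift.
Variables (I : R -> Prop) (F : free_complex K n).
Hypotheses (gF : graded_complex F) (rF : resolves F I).

Lemma lift_mx i m (M : 'M_(m, fr_rank F i)) :
  (forall r, cycle I (row r M)) -> exists N, N *m fr_diff F i = M.
Proof.
move=> h; have /fin_all_exists[w hw] : forall r, exists w,
    row r M = w *m fr_diff F i by move=> r; apply/(cycle_boundary rF).
by exists (\matrix_r w r); apply/row_matrixP => r; rewrite row_mul rowK.
Qed.

(** Any lift can be made homogeneous: replacing each row by its component of degree [s r] does not
    change the image, since [M] is homogeneous. *)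
Lemma lift_hmx i m (s : 'I_m -> nat) (M : 'M_(m, fr_rank F i)) :
  hmx s (@fr_shift _ _ F i) M -> (forall r, cycle I (row r M)) ->
  exists2 N, hmx s (@fr_shift _ _ F i.+1) N & N *m fr_diff F i = M.
Proof.
move=> /hmxP hM /lift_mx[N NE].
exists (\matrix_r hrow (s r) (@fr_shift _ _ F i.+1) (row r N)).
  exact: hrow_homog.
apply/row_matrixP => r; rewrite row_mul rowK -(hrow_mul _ _ (hmx_diff gF (i:=i))).
by rewrite -row_mul NE hM.
Qed.

Lemma diff_diff i : fr_diff F i.+1 *m fr_diff F i = 0.
Proof.
apply/row_matrixP => r; rewrite row_mul row0.
by apply/((cycle_boundary rF (i := i.+1)) _); exists (delta_mx 0 r); rewrite -rowE.
Qed.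

Lemma cycle_diff i (w : 'rV_(fr_rank F i.+1)) : cycle I (w *m fr_diff F i).
Proof. by apply/(cycle_boundary rF); exists w. Qed.

End Lift.

End Graded.

(** * Finite generation over polynomial rings *)

Section Hilbert.

Variables (K : fieldType) (n : nat).
Local Notation R := {mpoly K[n]}.

(** Dickson's lemma, by induction on the number [k] of exponents that are compared; the monomials
    keep all their variables. *)
Lemma dickson (S : 'X_{1..n} -> Prop) :
  exists2 s : seq 'X_{1..n}, (forall g, g \in s -> S g)
    & forall m, S m -> exists2 g, g \in s & (g <= m)%MM.
Proof.
suff /(_ n)[s sS h] : forall k, exists2 s : seq 'X_{1..n}, (forall g, g \in s -> S g)
    & forall m, S m ->
      exists2 g, g \in s & forall i : 'I_n, (i < k)%N -> (g i <= m i)%N.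
  exists s => // m /h[g gs le]; exists g => //; apply/mnm_lepP => i.
  exact/le/ltn_ord.
move=> k; elim: k S => [|k IH] S.
  have [[m Sm]|no] := classic (exists m, S m); last first.
    by exists [::] => // m Sm; case: no; exists m.
  by exists [:: m] => [g|m' _]; [rewrite inE => /eqP -> | exists m; rewrite ?inE].
have [lt_kn|le_nk] := ltnP k n; last first.
  have [s sS h] := IH S; exists s => // m /h[g gs le]; exists g => // i _.
  exact/le/(leq_trans (ltn_ord i)).
pose j := Ordinal lt_kn; have [s sS h] := IH S.
pose N := \max_(g <- s) g j.
(* A monomial of [S] whose exponent at [j] is at least [N] is already above an
   element of [s]; the smaller exponents are treated one at a time. *)
have /fin_all_exists[f hf] : forall c : 'I_N, exists t : seq 'X_{1..n},
    (forall g, g \in t -> S g /\ g j = c) /\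
    (forall m, S m /\ m j = c ->
       exists2 g, g \in t & forall i : 'I_n, (i < k)%N -> (g i <= m i)%N).
  by move=> c; have [t tS ht] := IH (fun m => S m /\ m j = c); exists t.
exists (s ++ flatten [seq f c | c <- enum 'I_N]) => [g|m Sm].
  rewrite mem_cat => /orP[/sS//|/flattenP[_ /mapP[c _ ->]]].
  by case: (hf c) => h1 _ /h1[].
have [leN|ltN] := leqP N (m j).
  have [g gs le] := h m Sm; exists g; first by rewrite mem_cat gs.
  move=> i; rewrite ltnS leq_eqVlt => /predU1P[ik|/le//].
  have -> : i = j by apply: val_inj.
  by apply: leq_trans leN; rewrite /N (big_rem g gs) leq_maxl.
have [h1 h2] := hf (Ordinal ltN).
have [g gf le] := h2 m (conj Sm erefl).
exists g.
  rewrite mem_cat; apply/orP; right; apply/flattenP.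
  by exists (f (Ordinal ltN)) => //; apply: map_f; rewrite mem_enum.
move=> i; rewrite ltnS leq_eqVlt => /predU1P[ik|/le//].
have -> : i = j by apply: val_inj.
by have [_ ->] := h1 g gf.
Qed.

Definition submodule m (Z : 'rV[R]_m -> Prop) :=
  [/\ Z 0, forall v w, Z v -> Z w -> Z (v + w) & forall p v, Z v -> Z (p *: v)].

Definition generates m k (D : 'M[R]_(k, m)) (Z : 'rV[R]_m -> Prop) :=
  (forall i, Z (row i D)) /\ forall v, Z v -> exists w, v = w *m D.

Lemma submodule_comb m (Z : 'rV[R]_m -> Prop) k (D : 'M[R]_(k, m)) w :
  submodule Z -> (forall i, Z (row i D)) -> Z (w *m D).
Proof.
case=> Z0 ZD ZZ h; rewrite mulmx_sum_row; elim/big_ind: _ => // i _.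
exact: ZZ.
Qed.

(** Hilbert's basis theorem by division: Dickson's lemma gives finitely many elements of [J] whose
    leading monomials divide every leading monomial of [J], and subtracting a multiple of one of
    them lowers the leading monomial. *)
Lemma fg_ideal (J : R -> Prop) :
  (forall p q, J p -> J q -> J (p + q)) -> (forall p q, J q -> J (p * q)) ->
  exists k (g : 'I_k -> R), (forall i, J (g i)) /\
    forall p, J p -> exists w : 'I_k -> R, p = \sum_i w i * g i.
Proof.
move=> JD JM.
have [s sS h] := dickson (fun m => exists2 p, J p & p != 0 /\ mlead p = m).
have /fin_all_exists[g hg] : forall i : 'I_(size s), exists p,
    [/\ J p, p != 0 & mlead p = nth 0%MM s i].
  by move=> i; have [p Jp [nz lp]] := sS _ (mem_nth 0%MM (ltn_ord i)); exists p.
exists (size s), g; split=> [i|p]; first by case: (hg i).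
elim/(well_founded_ind (@ltom_wf n)): (mlead p) {-2}p (erefl (mlead p)) => m IH {}p pm Jp.
have [->|nzp] := eqVneq p 0.
  by exists (fun _ => 0); rewrite big1 // => i _; rewrite mul0r.
have [gm gs] := h m (ex_intro2 _ _ p Jp (conj nzp pm)).
have [i <-] : exists i : 'I_(size s), nth 0%MM s i = gm.
  have lt : (index gm s < size s)%N by rewrite index_mem.
  by exists (Ordinal lt); rewrite nth_index.
case: (hg i) => Jg nzg <- le.
have cg : (g i)@_(mlead (g i)) != 0 by rewrite mleadc_eq0.
pose a : R := (p@_m / (g i)@_(mlead (g i))) *: 'X_[m - mlead (g i)].
have Jq : J (p - a * g i) by apply: JD => //; rewrite -mulNr; apply: JM.
have [w qE] : exists w : 'I_(size s) -> R, p - a * g i = \sum_j w j * g j.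
  have [->|nzq] := eqVneq (p - a * g i) 0.
    by exists (fun _ => 0); rewrite big1 // => j _; rewrite mul0r.
  apply: IH (erefl _) Jq.
  have lag : (mlead (a * g i) <= m)%O.
    apply: le_trans (mleadM_le _ _) _; rewrite -[X in (_ <= X)%O](submK le) lemc_add2l.
    by apply: le_trans (mleadZ_le _ _) _; rewrite mleadXm.
  rewrite lt_neqAle; apply/andP; split.
    apply: contraNneq nzq => e; rewrite -mleadc_eq0 e mcoeffB.
    have := mcoeffMX (g i) (m - mlead (g i)) (mlead (g i)); rewrite submK // => gE.
    by rewrite /a -scalerAl mcoeffZ ['X_[_] * _]mulrC gE -mulrA mulVf // mulr1 subrr.
  by apply: le_trans (mleadB_le _ _) _; rewrite leUx pm lexx.
exists (fun j => w j + (if j == i then a else 0)).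
under eq_bigr do rewrite mulrDl.
rewrite big_split -qE /= (bigD1 i) //= eqxx big1 ?addr0 ?subrK // => j /negPf ->.
by rewrite mul0r.
Qed.

(** Induction on the rank: the first coordinates of [Z] form an ideal, and the vectors of [Z] with
    first coordinate 0 form a submodule of smaller rank. *)
Lemma fg_submodule m (Z : 'rV[R]_m -> Prop) :
  submodule Z -> exists k (D : 'M_(k, m)), generates D Z.
Proof.
elim: m Z => [|m IH] Z [Z0 ZD ZZ].
  exists 0%N, 0; split=> [[]//|v _]; exists 0; rewrite mul0mx.
  by apply/rowP; case.
have [k [g [gJ gen]]] : exists k (g : 'I_k -> R),
    (forall i, exists2 v, Z v & v 0 0 = g i) /\
    forall p, (exists2 v, Z v & v 0 0 = p) ->
      exists w : 'I_k -> R, p = \sum_i w i * g i.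
  apply: fg_ideal => [_ _ [v Zv <-] [w Zw <-]|p _ [v Zv <-]].
    by exists (v + w); rewrite ?mxE //; apply: ZD.
  by exists (p *: v); rewrite ?mxE //; apply: ZZ.
have /fin_all_exists[G hG] : forall i, exists v, Z v /\ v 0 0 = g i.
  by move=> i; have [v] := gJ i; exists v.
pose Z' (v : 'rV_m) := Z (row_mx (0 : 'rV_1) v).
have [|k' [D' [ZD' gen']]] := IH Z'.
  rewrite /Z'; split=> [|v w Zv Zw|p v Zv]; first by rewrite row_mx0.
    by rewrite -[0]addr0 -add_row_mx; apply: ZD.
  by rewrite -[0](scaler0 _ p) -scale_row_mx; apply: ZZ.
pose M : 'M_(k, 1 + m) := \matrix_i G i.
have ZM i : Z (row i M) by rewrite rowK; case: (hG i).
exists (k + k')%N, (col_mx M (row_mx (0 : 'cV_k') D')); split=> [i|v Zv].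
  rewrite -(splitK i); case: (split i) => j /=.
    by rewrite rowKu.
  rewrite rowKd (@row_row_mx _ k' 1 m) row0; apply: ZD'.
have [w vE] := gen _ (ex_intro2 _ _ v Zv erefl).
pose w0 := \row_i w i.
(* Subtracting a combination of the rows of [M] kills the first coordinate, which leaves a vector
   handled by [D']. *)
pose u : 'rV_(1 + m) := v - w0 *m M.
have Zu : Z u.
  apply: (ZD) => //; rewrite -scaleN1r; apply: (ZZ).
  exact: (submodule_comb _ (And3 Z0 ZD ZZ)).
have u0 : lsubmx u = 0.
  apply/rowP => j; rewrite (ord1 j) !mxE (_ : lshift m 0 = 0); last exact: val_inj.
  rewrite vE; apply/eqP; rewrite subr_eq0; apply/eqP; apply: eq_bigr => i _.
  by rewrite !mxE; case: (hG i) => _ ->.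
rewrite -[u]hsubmxK u0 in Zu; have [w' w'E] := gen' _ Zu.
exists (row_mx w0 w'); rewrite mul_row_col (@mul_mx_row _ 1 k' 1 m) mulmx0 -w'E.
by rewrite -[0]u0 hsubmxK addrC subrK.
Qed.

End Hilbert.

(** * Existence of minimal resolutions *)

Section Existence.

Variables (K : fieldType) (n : nat).
Local Notation R := {mpoly K[n]}.

Definition graded_submodule m (s : 'I_m -> nat) (Z : 'rV[R]_m -> Prop) :=
  submodule Z /\ forall D v, Z v -> Z (hrow D s v).

(** For a nonzero polynomial [msize] is one more than the degree, so [N] exceeds every total degree
    that occurs. *)
Lemma sum_hrow m (s : 'I_m -> nat) (v : 'rV[R]_m) N :
  (forall j, (msize (v 0%R j) + s j <= N)%N) -> v = \sum_(D < N) hrow D s v.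
Proof.
move=> h; apply/rowP => j; rewrite summxE; apply/mpolyP => a.
rewrite raddf_sum /=.
under eq_bigr do rewrite mxE mcoeff_hpart.
have [a_v|/memN_msupp_eq0 ->] := boolP (a \in msupp (v 0 j)); last first.
  by rewrite big1 // => D _; rewrite if_same.
have lt : (mdeg a + s j < N)%N.
  by have := msize_mdeg_lt a_v; have := h j; lia.
rewrite (bigD1 (Ordinal lt)) //= eqxx big1 ?addr0 // => D ne.
by rewrite ifN //; apply: contra ne => /eqP e; apply/eqP/val_inj.
Qed.

(** The homogeneous components of finitely many generators generate as well, and only finitely many
    can be nonzero; they are indexed by pairs of a generator and a degree. *)
Lemma fg_graded m (s : 'I_m -> nat) (Z : 'rV[R]_m -> Prop) :
  graded_submodule s Z ->
  exists k (t : 'I_k -> nat) (D : 'M_(k, m)), hmx t s D /\ generates D Z.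
Proof.
case=> Zsub Zh; have [k [D [ZD gen]]] := fg_submodule Zsub.
pose N := \max_i \max_j (msize (D i j) + s j)%N.
pose T : finType := ('I_k * 'I_N)%type.
pose ev (r : 'I_#|T|) : T := enum_val r.
exists #|T|, (fun r => (ev r).2 : nat), (\matrix_r hrow (ev r).2 s (row (ev r).1 D)).
split; first exact: (@hrow_homog K n _ _ (fun r => nat_of_ord (ev r).2) s).
split=> [r|v /gen[w ->]]; first by rewrite rowK; apply/Zh/ZD.
exists (\row_r w 0 (ev r).1); rewrite !mulmx_sum_row.
under [RHS]eq_bigr do rewrite mxE rowK.
rewrite -(big_enum_val (fun x : T => w 0 x.1 *: hrow x.2 s (row x.1 D))).
rewrite -(pair_big xpredT xpredT (fun (i : 'I_k) (d : 'I_N) => w 0 i *: hrow d s (row i D))) /=.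
apply: eq_bigr => i _; rewrite -scaler_sumr -sum_hrow // => j.
rewrite mxE; apply: leq_trans (leq_bigmax i).
exact: (leq_bigmax j).
Qed.

Lemma ex_least (P : nat -> Prop) :
  (exists k, P k) -> exists k, P k /\ forall j, (j < k)%N -> ~ P j.
Proof.
case=> k; elim/ltn_ind: k => k IH Pk.
have [[j lt Pj]|no] := classic (exists2 j, (j < k)%N & P j); first exact: IH Pj.
by exists k; split=> // j lt Pj; apply: no; exists j.
Qed.

(** Containment of [Z] in the product of the ideal of the variables with the free module. *)
Definition const0 m (Z : 'rV[R]_m -> Prop) := forall v, Z v -> forall j, (v 0 j)@_0%MM = 0.

(* A homogeneous generating family of least cardinality has no relation with an
   invertible coefficient. *)
Lemma minimal_generators m (s : 'I_m -> nat) (Z : 'rV[R]_m -> Prop) :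
  graded_submodule s Z ->
  exists k (t : 'I_k -> nat) (D : 'M_(k, m)),
    [/\ hmx t s D, generates D Z & const0 (fun v => v *m D = 0)].
Proof.
move=> /fg_graded/ex_least[k [[t [D [hD [ZD gen]]]] least]].
exists k, t, D; split=> // v vD r; apply/eqP/negP => /negP nz.
case: k => [|k] in t D hD ZD gen least v vD r nz *; first by case: r nz.
case: (least k) => //.
exists (fun i => t (lift r i)), (row' r D); split.
  by move=> i j; rewrite mxE; apply: hD.
split=> [i|x /gen[w ->]].
  have -> : row i (row' r D) = row (lift r i) D by apply/rowP => j; rewrite !mxE.
  exact: ZD.
(* In degree [t r] the coefficient at [r] of the relation is reduced to its constant term, which is
   invertible. *)
pose v' := hrow (t r) t v.
have v'D : v' *m D = 0.
  by rewrite -(hrow_mul _ _ hD) vD; apply/rowP => j; rewrite !mxE linear0.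
have v'r : v' 0 r = ((v 0 r)@_0%MM)%:MP.
  apply/mpolyP => a; rewrite mxE mcoeff_hpart mcoeffC -{2}[t r]add0n eqn_add2r.
  by rewrite mdeg_eq0; case: eqP => [->|]; rewrite ?mulr1 ?mulr0.
(* Subtracting this multiple of the relation rewrites [w *m D] without the generator [r]. *)
pose u := w - (w 0 r * ((v 0 r)@_0%MM)^-1%:MP) *: v'.
have ur : u 0 r = 0.
  have -> : u 0 r = w 0 r - w 0 r * ((v 0 r)@_0%MM)^-1%:MP * v' 0 r by rewrite !mxE.
  rewrite v'r.
  by rewrite -mulrA -mpolyCM mulVf // mpolyC1 mulr1 subrr.
exists (col' r u).
have -> : w *m D = u *m D by rewrite mulmxBl -scalemxAl v'D scaler0 subr0.
apply/rowP => j; rewrite !mxE (bigD1_ord r) //= ur mul0r add0r.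
by apply: eq_bigr => i _; rewrite !mxE.
Qed.

(** The state of the construction of a resolution. The rows of the next differential will lie in
    [sm_set], so [sm_const0] makes that differential minimal. *)
Record syzygy_module := SyzygyModule {
  sm_rank : nat;
  sm_shift : 'I_sm_rank -> nat;
  sm_set : 'rV[R]_sm_rank -> Prop;
  sm_graded : graded_submodule sm_shift sm_set;
  sm_const0 : const0 sm_set }.

Lemma next_syzygy (Z : syzygy_module) :
  exists (Z' : syzygy_module) (D : 'M_(sm_rank Z', sm_rank Z)),
    [/\ hmx (@sm_shift Z') (@sm_shift Z) D, generates D (@sm_set Z)
      & @sm_set Z' = fun v => v *m D = 0].
Proof.
have [k [t [D [hD gen c0]]]] := minimal_generators (sm_graded Z).
have gr : graded_submodule t (fun v => v *m D = 0).
  split; first split=> [|v w v0 w0|p v v0].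
  - by rewrite mul0mx.
  - by rewrite mulmxDl v0 w0 addr0.
  - by rewrite -scalemxAl v0 scaler0.
  by move=> d v vD; rewrite -(hrow_mul _ _ hD) vD; apply/rowP => j; rewrite !mxE linear0.
by exists (SyzygyModule gr c0), D.
Qed.

(** The construction starts from [I] inside the free module of rank one and iterates [next_syzygy].
    The second hypothesis is the minimality condition for this first module. *)
Lemma exists_minimal_resolution (I : R -> Prop) :
  graded_ideal I -> (forall p, I p -> p@_0%MM = 0) ->
  exists F, minimal_graded_free_resolution F I.
Proof.
move=> hI I0.
have gr : @graded_submodule 1 (fun _ => 0%N) (fun v => I (v 0 0)).
  split; first split=> [|v w|p v].
  - by rewrite mxE; apply: (gideal0 hI).
  - by move=> Iv Iw; rewrite mxE; apply: (gidealD hI).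
  - by move=> Iv; rewrite mxE; apply: (gidealM hI).
  by move=> d v Iv; rewrite mxE; apply: (gideal_homog hI).
have c0 : @const0 1 (fun v => I (v 0 0)).
  by move=> v Iv j; rewrite (ord1 j); apply: I0.
pose next Z := sval (constructive_indefinite_description _ (next_syzygy Z)).
pose Zs i := iter i next (SyzygyModule gr c0).
(* The differential comes from the same choice as [Zs i.+1], so the ranks match by conversion. *)
pose D i := constructive_indefinite_description _
  (svalP (constructive_indefinite_description _ (next_syzygy (Zs i)))).
pose F := @FreeComplex K n (fun i => sm_rank (Zs i)) (fun i => @sm_shift (Zs i))
  (1%:M : 'cV_1) (fun i => sval (D i)).
have DP i : [/\ hmx (@sm_shift (Zs i.+1)) (@sm_shift (Zs i)) (fr_diff F i),
    generates (fr_diff F i) (@sm_set (Zs i))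
  & @sm_set (Zs i.+1) = fun v => v *m fr_diff F i = 0] := svalP (D i).
have ex i v : sm_set v <-> exists w, v = w *m fr_diff F i.
  case: (DP i) => _ [rows gen] _; split=> [/gen//|[w ->]].
  by case: (sm_graded (Zs i)) => Zsub _; apply: submodule_comb.
exists F; split.
- split=> [k|i]; last by case: (DP i).
  by rewrite /= mxE (ord1 k) eqxx dhomog1.
- split=> [p|v|i v].
  + exists (\row_j p); rewrite mulmx1 mxE subrr; exact: (gideal0 hI).
  + by rewrite mulmx1; apply: (ex 0%N).
  + by case: (DP i) => _ _ e; rewrite -ex e.
- move=> i r k; case: (DP i) => _ [rows _] _.
  by have := sm_const0 (rows r) k; rewrite mxE.
Qed.

End Existence.

(** * Comparison of resolutions *)

(** The type varies with the index because the components of a chain map are matrices of different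
    sizes. *)
Lemma dependent_choice (T : nat -> Type) (Q : forall i, T i -> T i.+1 -> Prop)
    (x : T 0%N) :
  (forall i x, exists y, Q i x y) ->
  exists f : forall i, T i, f 0%N = x /\ forall i, Q i (f i) (f i.+1).
Proof.
move=> h; pose next i y := constructive_indefinite_description _ (h i y).
pose f := fix f i : T i := match i with 0%N => x | i.+1 => sval (next i (f i)) end.
by exists f; split=> // i; apply: (svalP (next i (f i))).
Qed.

Section Comparison.

Variables (K : fieldType) (n : nat).
Local Notation R := {mpoly K[n]}.
Implicit Types (I : R -> Prop) (F G A B : free_complex K n).
Local Notation rk := fr_rank.
Local Notation shift F i := (@fr_shift _ _ F i).
Local Notation const := (map_mx (mcoeff (R := K) (0%MM : 'X_{1..n}))).

(* Chain maps lifting the multiplication by [f], a form of degree [d]. *)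
Record chain_map (f : R) (d : nat) A F I
    (phi : forall i, 'M[R]_(rk A i, rk F i)) : Prop := ChainMap {
  chain_hmx : forall i, hmx (fun k => (d + shift A i k)%N) (shift F i) (phi i);
  chain_aug : forall k, I ((phi 0%N *m fr_aug F - f *: fr_aug A) k 0);
  chain_diff : forall i, phi i.+1 *m fr_diff F i = fr_diff A i *m phi i }.

(** Compositions vanish, without exactness: this is what the source of a comparison map has to
    satisfy. *)
Definition complex_over A I :=
  (forall k, I ((fr_diff A 0%N *m fr_aug A) k 0)) /\
  forall i, fr_diff A i.+1 *m fr_diff A i = 0.

Lemma gideal_mulmx I m k (w : 'rV[R]_m) (X : 'M_(m, k)) j :
  graded_ideal I -> (forall r, I (X r j)) -> I ((w *m X) 0 j).
Proof.
by move=> hI h; rewrite mxE; apply: (gideal_sum hI) => r _; apply: (gidealM hI).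
Qed.

Lemma resolves_complex_over F I : resolves F I -> complex_over F I.
Proof.
move=> rF; split=> [k|i]; last exact: diff_diff rF i.
have := cycle_diff rF (i := 0%N) (delta_mx 0 k).
by rewrite /= -mulmxA -rowE mxE.
Qed.

(** The comparison theorem: free modules map from the source, and exactness of the target provides
    the next component, chosen homogeneous by [lift_hmx]. *)
Lemma exists_chain_map f d A IA F I :
  graded_complex A -> complex_over A IA ->
  graded_ideal I -> graded_complex F -> resolves F I ->
  f \is d.-homog -> (forall p, IA p -> I (f * p)) ->
  exists phi, chain_map f d I (A := A) (F := F) phi.
Proof.
move=> gA [cA0 cA] hI gF rF hf sub.
(* The second clause is what allows the next component to be lifted. *)
pose Q i (phi : 'M[R]_(rk A i, rk F i)) :=
  hmx (fun k => (d + shift A i k)%N) (shift F i) phi /\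
  forall r, cycle I (row r (fr_diff A i *m phi)).
have hdiff i : hmx (fun k => (d + shift A i.+1 k)%N)
    (fun k => (d + shift A i k)%N) (fr_diff A i).
  by move=> r k /(hmx_diff gA)[e -> he]; exists e; rewrite ?addnA.
have [phi0 [h0 aug0]] : exists phi0 : 'M_(rk A 0%N, rk F 0%N),
    hmx (fun k => (d + shift A 0%N k)%N) (shift F 0%N) phi0 /\
    forall k, I ((phi0 *m fr_aug F - f *: fr_aug A) k 0).
  have /fin_all_exists[v hv] : forall k, exists v : 'rV_(rk F 0%N),
      I ((f *: fr_aug A) k 0 - (v *m fr_aug F) 0 0).
    by move=> k; case: rF => h _ _; apply: h.
  exists (\matrix_k hrow (d + shift A 0%N k)%N (shift F 0%N) (v k)); split.
    exact: (@hrow_homog K n _ _ (fun k => d + shift A 0%N k)%N (shift F 0%N)).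
  (* Since [I] is homogeneous, the congruence survives when only the component of degree
     [d + shift A 0 k] is kept. *)
  move=> k; have /(gideal_homog hI (d + shift A 0%N k)%N) := hv k.
  have -> : pihomog mdeg (d + shift A 0%N k)%N ((f *: fr_aug A) k 0 - (v k *m fr_aug F) 0 0)
      = (f *: fr_aug A) k 0 - (hrow (d + shift A 0%N k)%N (shift F 0%N) (v k) *m fr_aug F) 0 0.
    rewrite -(hrow_mul _ _ (hmx_aug gF)) [hrow _ _ _ _ _]mxE /hpart subn0 leq0n linearB /=.
    congr (_ - _); apply: pihomog_dE; rewrite mxE; apply: dhomogM => //.
    by case: gA => h _; apply: h.
  move/(gidealN hI); rewrite opprB; congr I; rewrite !mxE.
  by congr (_ - _); apply: eq_bigr => j _; rewrite !mxE.
have Q0 : Q 0%N phi0.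
  split=> // r; rewrite /= row_mul -mulmxA.
  have -> : phi0 *m fr_aug F =
      (phi0 *m fr_aug F - f *: fr_aug A) + f *: fr_aug A by rewrite subrK.
  rewrite mulmxDr mxE; apply: (gidealD hI); first exact: gideal_mulmx.
  by rewrite -scalemxAr mxE; apply: sub; rewrite -row_mul mxE.
have [|phi [phi_0 phi_diff]] := @dependent_choice (fun i => {phi | Q i phi})
    (fun i x y => sval y *m fr_diff F i = fr_diff A i *m sval x) (exist _ phi0 Q0).
  move=> i [phi [hphi cphi]] /=.
  have [psi hpsi psiE] := lift_hmx gF rF (hmxM (hdiff i) hphi) cphi.
  have Qpsi : Q i.+1 psi.
    split=> // r; rewrite /= -row_mul -mulmxA psiE mulmxA cA mul0mx; exact: row0.
  by exists (exist _ psi Qpsi).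
exists (fun i => sval (phi i)); split=> [i||//]; first by case: (svalP (phi i)).
by rewrite phi_0.
Qed.

(** A chain map lifting zero is homotopic to zero, and both terms of the homotopy formula contain a
    differential, which vanishes modulo the variables. *)
Lemma null_homotopic_const0 A B IB
    (psi : forall i, 'M[R]_(rk A i, rk B i)) :
  resolves B IB -> minimal_complex A -> minimal_complex B ->
  (forall i, fr_diff A i.+1 *m fr_diff A i = 0) ->
  (forall k, IB ((psi 0%N *m fr_aug B) k 0)) ->
  (forall i, psi i.+1 *m fr_diff B i = fr_diff A i *m psi i) ->
  forall i, const (psi i) = 0.
Proof.
move=> rB mA mB cA psi0 psiE.
have cdiff F i : minimal_complex F -> const (fr_diff F i) = 0.
  by move=> mF; apply/matrixP => r k; rewrite !mxE mF.
(* [g] stands for the differential of [A] followed by the previous homotopy component; the next step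
   needs only these two properties of it. *)
suff h i : exists h g, [/\ psi i = h *m fr_diff B i + g, const g = 0
    & fr_diff A i *m g = 0].
  move=> i; have [hh [g [-> g0 _]]] := h i.
  by rewrite map_mxD map_mxM cdiff // mulmx0 add0r.
elim: i => [|i [h [g [psi_i g0 dg]]]].
  have [r|h hE] := @lift_mx _ _ IB B rB 0%N _ (psi 0%N).
    by rewrite /= -row_mul mxE.
  exists h, 0; rewrite hE addr0 map_mx0 mulmx0; split=> //.
have [r|k kE] := @lift_mx _ _ IB B rB i.+1 _ (psi i.+1 - fr_diff A i *m h).
  rewrite /= -row_mul mulmxBl psiE psi_i mulmxDr dg addr0 mulmxA subrr.
  exact: row0.
exists k, (fr_diff A i *m h); split; first by rewrite kE subrK.
  by rewrite map_mxM cdiff // mul0mx.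
by rewrite mulmxA cA mul0mx.
Qed.

(** [alpha] lifts [R/IA -> R/I] and [beta] lifts [R/I -> R/IB]. Their composite and [iota] lift the
    same map, so the difference is homotopic to zero and vanishes modulo the variables. *)
Lemma factor_const A IA F I B IB (iota : forall i, 'M[R]_(rk A i, rk B i)) :
  graded_ideal I -> graded_ideal IB ->
  (forall p, IA p -> I p) -> (forall p, I p -> IB p) ->
  graded_complex A -> complex_over A IA -> minimal_complex A ->
  graded_complex F -> resolves F I ->
  graded_complex B -> resolves B IB -> minimal_complex B ->
  iota 0%N *m fr_aug B = fr_aug A ->
  (forall i, iota i.+1 *m fr_diff B i = fr_diff A i *m iota i) ->
  forall i, exists2 alpha : 'M[R]_(rk A i, rk F i), hmx (shift A i) (shift F i) alpha
    & exists beta, const alpha *m const beta = const (iota i).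
Proof.
move=> hI hIB sAF sFB gA cA mA gF rF gB rB mB iota0 iotaE.
have [|alpha ha] := exists_chain_map gA cA hI gF rF (dhomog1 _ _).
  by move=> p /sAF; rewrite mul1r.
have [|beta hb] :=
    exists_chain_map gF (resolves_complex_over rF) hIB gB rB (dhomog1 _ _).
  by move=> p /sFB; rewrite mul1r.
move=> i; exists (alpha i); first by move=> r k /(chain_hmx ha).
exists (beta i); apply/eqP; rewrite -subr_eq0 -map_mxM -map_mxB; apply/eqP.
apply: (null_homotopic_const0 (psi := fun i => alpha i *m beta i - iota i) rB mA mB).
- by case: cA.
- move=> k; rewrite mulmxBl iota0 -mulmxA.
  have -> : beta 0%N *m fr_aug B = (beta 0%N *m fr_aug B - 1 *: fr_aug F) + fr_aug F.
    by rewrite scale1r subrK.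
  rewrite mulmxDr -addrA mxE; apply: (gidealD hIB).
    have := gideal_mulmx (row k (alpha 0%N)) hIB (chain_aug hb).
    by rewrite -row_mul mxE.
  by apply: sFB; have := chain_aug ha k; rewrite scale1r.
- move=> j; rewrite mulmxBl mulmxBr iotaE -mulmxA (chain_diff hb) !mulmxA.
  by rewrite (chain_diff ha).
Qed.

(** Each row of [alpha] must have an entry with nonzero constant term; being homogeneous, that entry
    has degree 0, so its two basis degrees agree. *)
Lemma unimodular_shift m k (s : 'I_m -> nat) (t : 'I_k -> nat)
    (alpha : 'M[R]_(m, k)) (X : 'M[K]_(k, m)) :
  hmx s t alpha -> const alpha *m X = 1%:M -> forall i, exists j, t j = s i.
Proof.
move=> h e i; have /matrixP/(_ i i) := e; rewrite !mxE eqxx => sum1.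
have [[j nz]|no] := classic (exists j, (alpha i j)@_0%MM != 0); last first.
  have /eqP := sum1; rewrite big1 ?(eq_sym 0) ?oner_eq0 // => j _.
  have [z|nz] := eqVneq ((alpha i j)@_0%MM) 0; first by rewrite mxE z mul0r.
  by case: no; exists j.
exists j; have /h[d -> hd] : alpha i j != 0.
  by apply: contraNneq nz => ->; rewrite mcoeff0.
have -> : d = 0%N; last by rewrite addn0.
apply/eqP; apply: contraNT nz => d0; apply/eqP.
by apply: (dhomog_nemf_coeff hd); rewrite mf0 eq_sym.
Qed.

(** The identity of [F] factors through [G] modulo the variables. Hence degree bounds on any graded
    resolution, such as a mapping cone, pass to the minimal one. *)
Lemma minimal_shift F G I :
  graded_ideal I -> minimal_graded_free_resolution F I ->
  graded_complex G -> resolves G I ->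
  forall i (k : 'I_(rk F i)), exists l : 'I_(rk G i), fr_shift l = fr_shift k.
Proof.
move=> hI [gF rF mF] gG rG i.
have [||alpha ha [beta e]] := @factor_const F I G I F I (fun i => 1%:M) hI hI
    (fun p => id) (fun p => id) gF (resolves_complex_over rF) mF gG rG gF rF mF _ _ i.
- by rewrite mul1mx.
- by move=> j; rewrite mul1mx mulmx1.
by apply: (unimodular_shift ha (X := const beta)); rewrite e map_mx1.
Qed.

(** Vectors are rows, so the right inverse [rho] makes [iota] split injective modulo the
    variables. *)
Definition embeds A B := exists (iota : forall i, 'M[R]_(rk A i, rk B i)),
  [/\ iota 0%N *m fr_aug B = fr_aug A,
      forall i, iota i.+1 *m fr_diff B i = fr_diff A i *m iota i
    & forall i, exists rho, const (iota i) *m rho = 1%:M].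

Lemma embeds_refl A : embeds A A.
Proof.
exists (fun i => 1%:M); split=> [|i|i]; rewrite ?mul1mx ?mulmx1 //.
by exists 1%:M; rewrite map_mx1 mulmx1.
Qed.

Lemma embeds_trans B A C : embeds A B -> embeds B C -> embeds A C.
Proof.
case=> f [f0 fE fr] [g [g0 gE gr]]; exists (fun i => f i *m g i); split=> [|i|i].
- by rewrite -mulmxA g0.
- by rewrite -mulmxA gE !mulmxA fE.
- have [r rE] := fr i; have [s sE] := gr i; exists (s *m r).
  by rewrite map_mxM mulmxA -[_ *m s]mulmxA sE mulmx1.
Qed.

Lemma embedded_shift A IA F I B IB :
  graded_ideal I -> graded_ideal IB ->
  (forall p, IA p -> I p) -> (forall p, I p -> IB p) ->
  minimal_graded_free_resolution A IA -> graded_complex F -> resolves F I ->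
  minimal_graded_free_resolution B IB -> embeds A B ->
  forall i (k : 'I_(rk A i)), exists l : 'I_(rk F i), fr_shift l = fr_shift k.
Proof.
move=> hI hIB sAF sFB [gA rA mA] gF rF [gB rB mB] [iota [iota0 iotaE rho]] i.
have [alpha ha [beta e]] := factor_const hI hIB sAF sFB gA
  (resolves_complex_over rA) mA gF rF gB rB mB iota0 iotaE i.
have [r rE] := rho i.
by apply: (unimodular_shift ha (X := const beta *m r)); rewrite mulmxA e.
Qed.

End Comparison.

(** * Mapping cones *)

Section Cone.

Variables (K : fieldType) (n : nat).
Local Notation R := {mpoly K[n]}.
Implicit Types (I : R -> Prop) (F G : free_complex K n).
Local Notation rk := fr_rank.
Local Notation shift F i := (@fr_shift _ _ F i).
Local Notation const := (map_mx (mcoeff (R := K) (0%MM : 'X_{1..n}))).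

Section Construction.

Variables (f : R) (d : nat) (F G : free_complex K n) (I IG : R -> Prop).
Variable phi : forall i, 'M[R]_(rk G i, rk F i).

(** In homological degree [i.+1] the mapping cone is the sum of [F] in degree [i.+1] and [G] in
    degree [i], the latter with shifts raised by [d], the degree of [f]. *)
Definition cone_rank i : nat :=
  match i with 0%N => rk F 0%N | i.+1 => (rk F i.+1 + rk G i)%N end.

Definition cone_shift i : 'I_(cone_rank i) -> nat :=
  match i with
  | 0%N => shift F 0%N
  | i.+1 => fun k => match split k with
                     | inl a => shift F i.+1 a
                     | inr b => (d + shift G i b)%N
                     end
  end.

Definition cone_diff i : 'M[R]_(cone_rank i.+1, cone_rank i) :=
  match i with
  | 0%N => col_mx (fr_diff F 0%N) (phi 0%N)
  | i.+1 => block_mx (fr_diff F i.+1) 0 (phi i.+1) (- fr_diff G i)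
  end.

Definition cone := @FreeComplex K n cone_rank cone_shift (fr_aug F) cone_diff.

Hypotheses (gF : graded_complex F) (gG : graded_complex G).
Hypotheses (rF : resolves F I) (rG : resolves G IG) (hI : graded_ideal I).
Hypotheses (colon : forall p, IG p <-> I (p * f)).
Hypothesis hphi : chain_map f d I (A := G) (F := F) phi.

Lemma graded_cone : graded_complex cone.
Proof.
split=> [k|i]; first by case: gF => h _; apply: h.
have hF j := hmx_diff gF (i := j); have hG j := hmx_diff gG (i := j).
have hP j := chain_hmx hphi (i := j).
case: i => [|i] r k /=; case: splitP => a ra.
- by rewrite (_ : r = lshift _ a) ?col_mxEu; [apply: hF | apply: val_inj].
- by rewrite (_ : r = rshift _ a) ?col_mxEd; [apply: hP | apply: val_inj].
- rewrite (_ : r = lshift _ a); last exact: val_inj.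
  case: splitP => b kb.
    by rewrite (_ : k = lshift _ b) ?block_mxEul; [apply: hF | apply: val_inj].
  by rewrite (_ : k = rshift _ b) ?block_mxEur ?mxE ?eqxx //; apply: val_inj.
rewrite (_ : r = rshift _ a); last exact: val_inj.
case: splitP => b kb.
  by rewrite (_ : k = lshift _ b) ?block_mxEdl; [apply: hP | apply: val_inj].
rewrite (_ : k = rshift _ b) ?block_mxEdr; last exact: val_inj.
rewrite mxE oppr_eq0 => /hG[e -> he].
by exists e; rewrite ?addnA // rpredN.
Qed.

Lemma cone_exact i (v1 : 'rV_(rk F i.+1)) (v2 : 'rV_(rk G i)) :
  v1 *m fr_diff F i + v2 *m phi i = 0 -> cycle IG v2 ->
  exists w, row_mx v1 v2 = w *m cone_diff i.+1.
Proof.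
move=> e /(cycle_boundary rG)[u uE].
have : cycle I (v1 + u *m phi i.+1) by rewrite /= mulmxDl -mulmxA (chain_diff hphi) mulmxA -uE.
move=> /(cycle_boundary rF)[w wE].
exists (row_mx w (- u)); rewrite mul_row_block mulmx0 add0r -wE mulNmx addrK.
by rewrite mulmxN mulNmx opprK uE.
Qed.

(** The cone realizes the exact sequence [0 -> R/(I : f) -> R/I -> R/(I + (f)) -> 0], whose first
    map is multiplication by [f]; here [IG] is [I : f], and the resolved ideal is [I + (f)]. *)
Lemma resolves_cone : resolves cone (fun p => exists q, I (p - q * f)).
Proof.
have ph0 (w : 'rV_(rk G 0%N)) :
    I ((w *m phi 0%N *m fr_aug F) 0 0 - (w *m fr_aug G) 0 0 * f).
  have := gideal_mulmx w hI (chain_aug hphi).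
  rewrite mulmxBr mulmxA -scalemxAr; set a := w *m _ *m _; set b := w *m _.
  by rewrite !mxE [f * _]mulrC.
split=> [p|v|i v].
- by case: rF => /(_ p)[v hv] _ _; exists v, 0; rewrite mul0r subr0.
- split=> [[q hq]|[w ->]].
    case: rG => /(_ q)[u /colon hu] _ _.
    (* Modulo [I] the augmentation of [v] is [q * f], and [u] lifts [q] modulo the colon ideal, so
       the difference is a cycle of [F]. *)
    have : @cycle _ _ F I 0%N (v - u *m phi 0%N).
      rewrite /= mulmxBl [X in I X](_ : _ = ((v *m fr_aug F) 0 0 - q * f) +
        (q - (u *m fr_aug G) 0 0) * f -
        ((u *m phi 0%N *m fr_aug F) 0 0 - (u *m fr_aug G) 0 0 * f)).
        by apply: (gidealB hI) => //; apply: (gidealD hI).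
      rewrite [LHS](_ : _ = (v *m fr_aug F) 0 0 - (u *m phi 0%N *m fr_aug F) 0 0).
        by ring.
      by rewrite !mxE.
    move=> /(cycle_boundary rF)[w wE].
    by exists (row_mx w u); rewrite mul_row_col -wE subrK.
  exists ((rsubmx w *m fr_aug G) 0 0).
  have -> : w *m fr_diff cone 0%N =
      lsubmx w *m fr_diff F 0%N + rsubmx w *m phi 0%N by rewrite -mul_row_col hsubmxK.
  rewrite mulmxDl mxE -addrA.
  apply: (gidealD hI) => //; exact: (cycle_diff rF (i := 0%N)).
split=> [|[w ->]].
  case: i v => [|i] v /=; rewrite -[v]hsubmxK.
    rewrite mul_row_col => e; apply: cone_exact => //=.
    (* The image of the [G] part under [phi] is a boundary of [F], so [f] times its augmentation
       lies in [I]. *)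
    apply/colon; have := ph0 (rsubmx v).
    have -> : rsubmx v *m phi 0%N = - (lsubmx v *m fr_diff F 0%N).
      by apply/eqP; rewrite -addr_eq0 addrC e.
    move=> h; have /(gidealN hI) := gidealD hI h (cycle_diff rF (i := 0%N) (lsubmx v)).
    rewrite (_ : (- _ *m _) 0 0 = - (lsubmx v *m fr_diff F 0%N *m fr_aug F) 0 0).
      by rewrite addrAC addNr add0r opprK.
    by rewrite mulNmx mxE.
  rewrite mul_row_block mulmx0 add0r -(row_mx0 _ 1) => /eq_row_mx[e1 e2].
  apply: cone_exact => //=; apply/eqP; rewrite -oppr_eq0 -mulmxN; exact/eqP.
case: i v w => [|i] v w /=; rewrite -mulmxA.
  rewrite mul_block_col mul0mx addr0 (diff_diff rF) (chain_diff hphi) mulNmx subrr.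
  by rewrite col_mx0 mulmx0.
rewrite mulmx_block !mul0mx !mulmx0 !addr0 (diff_diff rF) (chain_diff hphi).
by rewrite mulNmx subrr add0r mulNmx mulmxN opprK (diff_diff rG) block_mx0 mulmx0.
Qed.

Lemma minimal_cone : minimal_complex F -> minimal_complex G ->
  (forall i, const (phi i) = 0) -> minimal_complex cone.
Proof.
move=> mF mG mphi.
have c0 m k (M : 'M[R]_(m, k)) : const M = 0 -> forall i j, (M i j)@_0%MM = 0.
  by move=> /matrixP h i j; have := h i j; rewrite !mxE.
have cdiff H i : minimal_complex H -> const (fr_diff H i) = 0.
  by move=> mH; apply/matrixP => r k; rewrite !mxE mH.
move=> i; apply: c0; case: i => [|i] /=.
  by rewrite map_col_mx mphi cdiff // col_mx0.
by rewrite map_block_mx map_mxN map_mx0 mphi !cdiff // oppr0 block_mx0.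
Qed.

Lemma embeds_cone : embeds F cone.
Proof.
exists (fun i => match i return 'M[R]_(rk F i, cone_rank i) with
  | 0%N => 1%:M | i.+1 => row_mx 1%:M 0 end); split.
- by rewrite mul1mx.
- case=> [|i] /=; first by rewrite mul_row_col mul1mx mul0mx mulmx1 addr0.
  by rewrite mul_row_block mul_mx_row !mul1mx !mul0mx !addr0 mulmx1 mulmx0.
- case=> [|i] /=; first by exists 1%:M; rewrite map_mx1 mulmx1.
  exists (col_mx 1%:M 0).
  by rewrite map_row_mx mul_row_col map_mx1 map_mx0 mul0mx mulmx1 addr0.
Qed.

End Construction.

Lemma chain_map_scalar (f : R) d F I : graded_ideal I -> f \is d.-homog ->
  chain_map f d I (A := F) (F := F) (fun i => f%:M).
Proof.
move=> hI hf; split=> [i r k|k|i]; last by rewrite mul_scalar_mx scalar_mxC mul_scalar_mx.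
  rewrite mxE; have [->|_] := eqVneq r k; last by rewrite eqxx.
  by move=> _; exists d; rewrite ?mulr1n // addnC.
by rewrite mul_scalar_mx subrr mxE; apply: (gideal0 hI).
Qed.

End Cone.

(** * Monomial ideals *)

Section MonomialIdeals.

Variables (K : fieldType) (n : nat).
Local Notation R := {mpoly K[n]}.
Implicit Types (p q : R) (U : pred 'X_{1..n}) (m a b : 'X_{1..n}).
Local Notation rk := fr_rank.

(** For an up-closed [U] this is the monomial ideal spanned by [U]. Colons and sums with a monomial
    become operations on [U]. *)
Definition mideal U p : Prop := forall m, p@_m != 0 -> U m.

Definition up_closed U := forall a b, U a -> U (a + b)%MM.

Lemma graded_mideal U : up_closed U -> graded_ideal (mideal U).
Proof.
move=> up; split=> [m|p q hp hq m|p q hq m|d p hp m].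
- by rewrite mcoeff0 eqxx.
- rewrite mcoeffD; have [p0|/hp//] := eqVneq p@_m 0.
  by rewrite p0 add0r => /hq.
- rewrite -mcoeff_msupp => /msuppM_le/allpairsP[[a b] [_ /= bq ->]].
  by rewrite addmC; apply/up/hq; rewrite -mcoeff_msupp.
- by rewrite mcoeff_pihomog; case: ifP => _; [apply: hp | rewrite eqxx].
Qed.

Lemma mideal_colon U m p :
  mideal (fun a => U (a + m)%MM) p <-> mideal U (p * 'X_[m]).
Proof.
split=> h a.
  rewrite -mcoeff_msupp (perm_mem (msuppMX _ _)) => /mapP[b bp ->].
  by rewrite addmC; apply: h; rewrite -mcoeff_msupp.
by rewrite -(mcoeffMX p m a) addmC; apply: h.
Qed.

Lemma mideal_add U m p : up_closed U ->
  (exists q, mideal U (p - q * 'X_[m])) <-> mideal (fun a => U a || (m <= a)%MM) p.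
Proof.
move=> up; split=> [[q hq] a|hp].
  have -> : p = p - q * 'X_[m] + q * 'X_[m] by rewrite subrK.
  rewrite mcoeffD; have [->|/hq -> //] := eqVneq ((p - q * 'X_[m])@_a) 0.
  rewrite add0r -mcoeff_msupp (perm_mem (msuppMX _ _)) => /mapP[b _ ->].
  by rewrite lem_addr orbT.
(* The quotient collects the terms of [p] divisible by the monomial [m], each divided by it. *)
exists (\sum_(a <- msupp p | (m <= a)%MM) p@_a *: 'X_[a - m]).
rewrite {1}(mpolyE p) big_distrl /= (bigID (fun a => (m <= a)%MM)) /=.
under [X in _ - X]eq_bigr => a ma do rewrite -scalerAl -mpolyXD submK //.
rewrite addrC addrK => b; rewrite raddf_sum /= => nz.
have [a /andP[nma ap] ab] : exists2 a, ~~ (m <= a)%MM && (a \in msupp p) & b = a.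
  apply: NNPP => no; case/negP: nz; apply/eqP; rewrite big_seq_cond big1 // => a.
  rewrite andbC => h; rewrite mcoeffZ mcoeffX; case: eqVneq => [ab|]; last by rewrite mulr0.
  by case: no; exists a.
by rewrite ab; move: (hp a); rewrite -mcoeff_msupp ap (negPf nma) orbF; apply.
Qed.

Lemma resolves_ext (I J : R -> Prop) F : (forall p, I p <-> J p) ->
  resolves F I -> resolves F J.
Proof.
move=> e [h1 h2 h3]; split=> // [p|v]; last by rewrite -e.
by have [v hv] := h1 p; exists v; apply/e.
Qed.

(** The resolution need not be minimal, so mapping cones can be used as they are; [minimal_shift]
    later transfers the bound. *)
Definition reg_le U r := exists F : free_complex K n,
  [/\ graded_complex F, resolves F (mideal U)
    & forall i (k : 'I_(rk F i)), (fr_shift k <= i + r)%N].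

Lemma reg_le_ext U U' r : U =1 U' -> reg_le U r -> reg_le U' r.
Proof.
move=> e [F [gF rF h]]; exists F; split=> //; apply: resolves_ext rF => p.
by split=> hp m /hp; rewrite e.
Qed.

(** In the cone, the generators coming from [G] gain [mdeg m] in degree and 1 in homological degree,
    which explains [t.+1]. *)
Lemma reg_le_add U m r s t : up_closed U ->
  reg_le U r -> reg_le (fun a => U (a + m)%MM) s ->
  (r <= t)%N -> (s + mdeg m <= t.+1)%N ->
  reg_le (fun a => U a || (m <= a)%MM) t.
Proof.
move=> up [F [gF rF hF]] [G [gG rG hG]] rt st.
have hI := graded_mideal up.
have hX : ('X_[m] : R) \is (mdeg m).-homog by rewrite dhomogX.
have [|phi hphi] := exists_chain_map gG (resolves_complex_over rG) hI gF rF hX.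
  by move=> p /mideal_colon; rewrite mulrC.
exists (cone (mdeg m) phi); split; first exact: graded_cone hphi.
  have := resolves_cone rF rG hI (fun p => mideal_colon U m p) hphi.
  by apply: resolves_ext => p; apply: mideal_add.
case=> [|i] k /=; first by apply: leq_trans (hF 0%N k) _; rewrite leq_add2l.
case: (split k) => b; first by have := hF _ b; lia.
by have := hG _ b; lia.
Qed.

(** * Minimal resolutions extended by regular sequences of monomials *)

Definition trivial_complex : free_complex K n :=
  FreeComplex (fr_rank := fun i => if i is 0%N then 1%N else 0%N) (fun i _ => 0%N)
    (1%:M : 'cV_1) (fun i => 0).

Lemma minimal_trivial :
  minimal_graded_free_resolution trivial_complex (mideal pred0).
Proof.
split; last by move=> i [].
  split=> [k|i []//].
  by rewrite (ord1 k) mxE eqxx dhomog1.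
split=> [p|v|i v].
- by exists (\row_j p); rewrite mulmx1 mxE subrr => m; rewrite mcoeff0 eqxx.
- rewrite mulmx1; split=> [h|[w ->] m]; last by rewrite mulmx0 mxE mcoeff0 eqxx.
  exists 0; rewrite mul0mx; apply/rowP => j; rewrite (ord1 j) mxE; apply/mpolyP => m.
  by rewrite mcoeff0; apply/eqP; apply: contraT => /h.
- by split=> _; [exists 0; apply/rowP; case | rewrite /= mulmx0].
Qed.

Lemma reg_le_pred0 : reg_le pred0 0.
Proof.
by exists trivial_complex; case: minimal_trivial => g r _; split=> // i k; rewrite addn0.
Qed.

(** The monomial is regular modulo [U], so the colon ideal is the ideal itself and the cone of
    multiplication by it on [F] is a resolution, minimal because [m] is not 1. *)
Lemma regular_extension U m F : up_closed U -> (forall a, U (a + m)%MM = U a) ->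
  m != 0%MM -> minimal_graded_free_resolution F (mideal U) ->
  exists F', [/\ minimal_graded_free_resolution F' (mideal (fun a => U a || (m <= a)%MM)),
    embeds F F'
  & forall i (k : 'I_(rk F i)),
      exists l : 'I_(rk F' i.+1), fr_shift l = (mdeg m + fr_shift k)%N].
Proof.
move=> up col nz [gF rF mF]; have hI := graded_mideal up.
have hX : ('X_[m] : R) \is (mdeg m).-homog by rewrite dhomogX.
have hphi := @chain_map_scalar K n 'X_[m] (mdeg m) F _ hI hX.
have colon p : mideal U p <-> mideal U (p * 'X_[m]).
  by rewrite -mideal_colon; split=> h a /h; rewrite col.
exists (cone (F := F) (G := F) (mdeg m) (fun i => 'X_[m]%:M)); split; last first.
- move=> i k; exists (rshift (rk F i.+1) k) => /=.
  by rewrite (unsplitK (inr k)).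
- exact: embeds_cone.
split; first exact: (graded_cone gF gF hphi).
  apply: resolves_ext (resolves_cone rF rF hI colon hphi) => p; exact: mideal_add.
apply: minimal_cone => // i; rewrite map_scalar_mx /= mcoeffX (negPf nz).
by apply/matrixP => r k; rewrite !mxE mul0rn.
Qed.

Definition mcoprime m a := [forall i, (m i == 0%N) || (a i == 0%N)].

Lemma lem_add_coprime m a b : mcoprime m b -> (m <= a + b)%MM = (m <= a)%MM.
Proof.
move=> /forallP co; apply/mnm_lepP/mnm_lepP => h i; have := h i; have := co i.
  by rewrite mnmDE => /orP[/eqP->//|/eqP->]; rewrite addn0.
by rewrite mnmDE => _ le; apply: leq_trans le (leq_addr _ _).
Qed.

(** Each extension moves the basis element [k] to its copy in the second summand of the cone.
    Starting from the unit in degree 0, this reaches the top of the Koszul complex. *)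
Lemma regular_sequence_extension (ms : seq 'X_{1..n}) U F i (k : 'I_(rk F i)) :
  up_closed U -> {in ms, forall m a, U (a + m)%MM = U a} ->
  {in ms, forall m, m != 0%MM} -> pairwise mcoprime ms ->
  minimal_graded_free_resolution F (mideal U) ->
  exists F', [/\ minimal_graded_free_resolution F'
                   (mideal (fun a => U a || has (fun m => (m <= a)%MM) ms)),
    embeds F F'
  & exists l : 'I_(rk F' (size ms + i)),
      fr_shift l = (fr_shift k + \sum_(m <- ms) mdeg m)%N].
Proof.
elim: ms U F i k => [|m ms IH] U F i k up col nz co mF /=.
  exists F; split; last by exists k; rewrite big_nil addn0.
    case: mF => gF rF mF; split=> //; apply: resolves_ext rF => p.
    by split=> h a /h; rewrite orbF.
  exact: embeds_refl.
case/andP: co => /allP com co.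
have [||F1 [mF1 e1 s1]] := @regular_extension U m F up _ _ mF.
- by move=> a; rewrite col ?mem_head.
- by rewrite nz ?mem_head.
have [l1 l1E] := s1 _ k.
have [|||F2 [mF2 e2 [l2 l2E]]] := IH _ F1 _ l1 _ _ _ co mF1.
- move=> a b /orP[/up-> //|le]; apply/orP; right.
  exact: lepm_trans le (lem_addr _ _).
(* Coprimality with [m] keeps the remaining monomials regular after [m] has been added. *)
- move=> b bm a; rewrite col ?inE ?bm ?orbT // lem_add_coprime //.
  exact: com.
- by move=> b bm; rewrite nz ?inE ?bm ?orbT.
exists F2; split; last first.
- by rewrite addSnnS; exists l2; rewrite l2E l1E big_cons; lia.
- exact: embeds_trans e1 e2.
case: mF2 => g2 r2 m2; split=> //; apply: resolves_ext r2 => p.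
by split=> h a /h; rewrite orbA.
Qed.

End MonomialIdeals.

(** * Induced matchings and simplicial vertices *)

Section Graphs.

Variable V : finType.
Implicit Types (e : rel V) (M : {set {set V}}) (A B : {set V}) (u v w x y : V).

Lemma edgesP e A : reflect (exists u v, e u v /\ A = [set u; v]) (A \in edges e).
Proof.
apply: (iffP imsetP) => [[[u v]]|[u [v [euv ->]]]].
  by rewrite inE /= => euv ->; exists u, v.
by exists (u, v); rewrite ?inE.
Qed.

Lemma mem_edges e u v : e u v -> [set u; v] \in edges e.
Proof. by move=> euv; apply/edgesP; exists u, v. Qed.

Lemma edge_at e A x : ssrbool.symmetric e -> A \in edges e -> x \in A ->
  exists2 y, e x y & A = [set x; y].
Proof.
move=> es /edgesP[u [v [euv ->]]] /set2P[->|->]; first by exists v.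
by exists u; [rewrite es | rewrite setUC].
Qed.

Lemma induced_matchingP e M : reflect
  [/\ {subset M <= edges e}, {in M &, forall A B, A != B -> [disjoint A & B]}
    & forall u v, e u v -> u \in cover M -> v \in cover M -> [set u; v] \in M]
  (induced_matching e M).
Proof.
apply: (iffP and3P) => [[/subsetP sM /trivIsetP tM /forall_inP iM]|[sM tM iM]]; split=> //.
- move=> u v euv uM vM; apply: (implyP (iM _ (mem_edges euv))).
  by apply/subsetP => w /set2P[] ->.
- exact/subsetP.
- exact/trivIsetP.
- apply/forall_inP => A /edgesP[u [v [euv ->]]]; apply/implyP => /subsetP s.
  by apply: iM => //; apply: s; rewrite ?set21 ?set22.
Qed.

Lemma induced_matching0 e : induced_matching e set0.
Proof.
apply/induced_matchingP; split=> [A|A B|u v _]; rewrite ?inE //.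
by rewrite /cover big_set0 inE.
Qed.

Definition clique_neighbours e x := forall y w, e x y -> e x w -> y != w -> e y w.

Definition delete_edge e x v : rel V := fun a b =>
  e a b && ~~ (((a == x) && (b == v)) || ((a == v) && (b == x))).

(** The closed neighbourhood of [v] is made isolated rather than removed, so all graphs share one
    vertex type and one polynomial ring. *)
Definition delete_closed_neighbours e v : rel V := fun a b =>
  [&& e a b, ~~ ((a == v) || e v a) & ~~ ((b == v) || e v b)].

(** * Induced matchings near a simplicial vertex *)

Section Simplicial.

Variables (e : rel V) (x v : V).
Hypotheses (es : ssrbool.symmetric e) (ei : irreflexive e).
Hypotheses (exv : e x v) (ex : clique_neighbours e x).
Local Notation e1 := (delete_edge e x v).
Local Notation e2 := (delete_closed_neighbours e v).

Lemma delete_edge_sym : ssrbool.symmetric e1.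
Proof. by move=> a b; rewrite /delete_edge es orbC [(b == x) && _]andbC [(b == v) && _]andbC. Qed.

Lemma delete_closed_neighbours_sym : ssrbool.symmetric e2.
Proof. by move=> a b; rewrite /delete_closed_neighbours es [_ && ~~ _]andbC. Qed.

Let neq_xv : x != v.
Proof. by apply: contraTneq exv => ->; rewrite ei. Qed.

(** Only the edge [xv] could spoil inducedness. If [M] covers both ends and matches [x] with [y],
    then [y] is adjacent to [v] because [x] is simplicial, so [yv] belongs to [M] and meets [xy]. *)
Lemma induced_matching_delete_edge :
  (induced_matching_number e1 <= induced_matching_number e)%N.
Proof.
apply/bigmax_leqP => M /induced_matchingP[sM tM iM].
apply: leq_bigmax_cond; apply/induced_matchingP; split=> //.
  by move=> A /sM/edgesP[a [b [/andP[eab _] ->]]]; apply: mem_edges.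
move=> a b eab aM bM; have [/iM->//|] := boolP (e1 a b).
rewrite /delete_edge eab negbK => ab.
suff : False by [].
have [xM vM] : x \in cover M /\ v \in cover M.
  by case/orP: ab => /andP[/eqP <- /eqP <-].
case/bigcupP: xM => B BM xB; case/bigcupP: (vM) => C CM vC.
have [y /andP[exy]] := edge_at delete_edge_sym (sM _ BM) xB.
rewrite eqxx /= (negPf neq_xv) /= orbF => yv BE.
have neq_yx : y != x by apply: contraTneq exy => ->; rewrite ei.
have e1yv : e1 y v.
  by rewrite /delete_edge (ex exy exv yv) (negPf yv) (negPf neq_yx).
have yB : y \in B by rewrite BE set22.
have yvM : [set y; v] \in M.
  by apply: iM => //; apply/bigcupP; exists B.
have [BE'|ne] := eqVneq B [set y; v]; last first.
  by have /pred0P/(_ y) := tM _ _ BM yvM ne; rewrite /= yB set21.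
move: xB; rewrite BE' => /set2P[xy|xv]; first by rewrite xy eqxx in neq_yx.
by have := neq_xv; rewrite xv eqxx.
Qed.

(** The edge [xv] can be added: [M] avoids the closed neighbourhood of [v], which contains that of
    [x] because [x] is simplicial. *)
Lemma induced_matching_delete_closed_neighbours :
  (induced_matching_number e2 < induced_matching_number e)%N.
Proof.
suff h M : induced_matching e2 M -> (#|M| < induced_matching_number e)%N.
  (* The empty matching shows that the bound is positive, so the strict inequality can be written
     with a predecessor. *)
  have := h _ (induced_matching0 _); rewrite cards0 => lt0.
  rewrite -(prednK lt0) ltnS; apply/bigmax_leqP => M /h; lia.
move=> /induced_matchingP[sM tM iM].
have far y : y \in cover M -> ~~ ((y == v) || e v y).
  case/bigcupP => A AM yA.
  by have [z /and3P[_]] := edge_at delete_closed_neighbours_sym (sM _ AM) yA.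
have xM : x \notin cover M by apply/negP => /far; rewrite es exv orbT.
have vM : v \notin cover M by apply/negP => /far; rewrite eqxx.
have dis A : A \in M -> [disjoint [set x; v] & A].
  move=> AM; apply/pred0P => y /=; apply/andP => -[yxv yA].
  have yM : y \in cover M by apply/bigcupP; exists A.
  by case/set2P: yxv yM xM vM => ->; move=> ->.
have new : [set x; v] \notin M.
  apply: contra xM => AM; apply/bigcupP; exists [set x; v]; rewrite ?set21 //.
have -> : #|M|.+1 = #|[set x; v] |: M| by rewrite cardsU1 new.
apply: leq_bigmax_cond; apply/induced_matchingP; split.
- move=> A /setU1P[->|/sM/edgesP[a [b [/and3P[eab _ _] ->]]]]; exact: mem_edges.
- move=> A B /setU1P[->|AM] /setU1P[->|BM] ne; rewrite ?eqxx // in ne *.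
  - exact: dis.
  - by rewrite disjoint_sym; apply: dis.
  - exact: tM.
- have coverE : cover ([set x; v] |: M) = [set x; v] :|: cover M by rewrite /cover big_setU1.
  have key a b : e a b -> a \in [set x; v] -> b \in [set x; v] :|: cover M ->
      [set a; b] \in [set x; v] |: M.
    move=> eab /set2P a_xv; rewrite in_setU => /orP[/set2P b_xv|/far].
      by case: a_xv b_xv eab => -> [] ->; rewrite ?ei // => _; rewrite 1?[[set v; x]]setUC setU11.
    case: a_xv eab => -> eab; last by rewrite eab orbT.
    rewrite negb_or => /andP[bv]; rewrite (ex exv eab) //; by rewrite eq_sym.
  move=> a b eab; rewrite coverE => /setUP[aS|aM]; first exact: key.
  move=> /setUP[bS|bM].
    by rewrite setUC; apply: key; rewrite 1?es // inE aM orbT.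
  rewrite setU1r // iM // /delete_closed_neighbours eab.
  by rewrite !far.
Qed.

End Simplicial.

(* Listing the vertices by increasing [rho] is a perfect elimination order. *)
Definition elimination_order (rho : V -> nat) e :=
  forall u v w, e u v -> e u w -> v != w ->
    (rho u < rho v)%N -> (rho u < rho w)%N -> e v w.

End Graphs.

(** * Edge ideals *)

Section EdgeIdeals.

Variables (K : fieldType) (V : finType).
Local Notation n := #|V|.
Local Notation R := {mpoly K[n]}.
Implicit Types (e : rel V) (M : {set {set V}}) (A B : {set V}) (u v w x y : V).
Implicit Types (a b m : 'X_{1..n}).
Local Notation rk := fr_rank.

Definition occurs a v := (0 < a (enum_rank v))%N.

Definition set_monomial A : 'X_{1..n} := [multinom (enum_val i \in A : nat) | i < n].

Lemma set_monomial_le A a :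
  (set_monomial A <= a)%MM = [forall v in A, occurs a v].
Proof.
apply/mnm_lepP/forall_inP => h.
  move=> v vA; have := h (enum_rank v); rewrite mnmE enum_rankK vA.
  by rewrite /occurs; lia.
move=> i; rewrite mnmE; case: (boolP (_ \in A)) => // /h.
by rewrite /occurs enum_valK; lia.
Qed.

Lemma occurs_add a A v : occurs (a + set_monomial A)%MM v = occurs a v || (v \in A).
Proof.
by rewrite /occurs mnmDE mnmE enum_rankK; case: (v \in A) => /=; lia.
Qed.

Lemma mdeg_set_monomial A : mdeg (set_monomial A) = #|A|.
Proof.
rewrite mdegE (reindex (@enum_rank V)) /=; last exact/onW_bij/enum_rank_bij.
rewrite -[RHS]sum1_card [RHS]big_mkcond /=.
by apply: eq_bigr => v _; rewrite mnmE enum_rankK; case: (_ \in A).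
Qed.

Lemma coprime_set_monomial A B :
  [disjoint A & B] -> mcoprime (set_monomial A) (set_monomial B).
Proof.
move=> /pred0P dis; apply/forallP => i; rewrite !mnmE.
by have := dis (enum_val i) => /=; case: (_ \in A); case: (_ \in B).
Qed.

Definition edge_monomials e : pred 'X_{1..n} := fun a =>
  [exists p : V * V, [&& e p.1 p.2, occurs a p.1 & occurs a p.2]].

Lemma edge_monomialsP e a :
  reflect (exists u v, [/\ e u v, occurs a u & occurs a v]) (edge_monomials e a).
Proof.
apply: (iffP existsP) => [[[u v] /and3P[? ? ?]]|[u [v [? ? ?]]]].
  by exists u, v.
by exists (u, v); apply/and3P.
Qed.

Lemma up_edge_monomials e : up_closed (edge_monomials e).
Proof.
move=> a b /edge_monomialsP[u [v [euv au av]]]; apply/edge_monomialsP.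
by exists u, v; split=> //; rewrite /occurs mnmDE; rewrite /occurs in au av; lia.
Qed.

Lemma edge_monomial u v : u != v ->
  'X_(enum_rank u) * 'X_(enum_rank v) = 'X_[set_monomial [set u; v]] :> R.
Proof.
move=> uv; rewrite -mpolyXD; congr mpolyX; apply/mnmP => i.
have rankE w : (enum_rank w == i) = (enum_val i == w).
  by rewrite -(inj_eq (can_inj (@enum_valK V))) enum_rankK eq_sym.
rewrite mnmDE !mnm1E mnmE !inE !rankE.
by have [->|] := eqVneq (enum_val i) u; rewrite ?(negPf uv).
Qed.

Lemma edge_idealE e : irreflexive e -> forall p,
  edge_ideal K e p <-> mideal (edge_monomials e) p.
Proof.
move=> ei p; have hI := graded_mideal K (@up_edge_monomials e).
have ne u v : e u v -> u != v by apply: contraTneq => ->; rewrite ei.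
split=> [[c ->]|hp].
  apply: (gideal_sum hI) => u _; apply: (gideal_sum hI) => v euv.
  apply: (gidealM hI); rewrite (edge_monomial (ne _ _ euv)) => m.
  rewrite mcoeffX; case: (_ =P m) => [<- _|_]; last by rewrite eqxx.
  apply/edge_monomialsP; exists u, v.
  by rewrite -[set_monomial _](add0m) !occurs_add set21 set22 !orbT.
have add q r : edge_ideal K e q -> edge_ideal K e r -> edge_ideal K e (q + r).
  case=> c -> [d ->]; exists (fun u v => c u v + d u v); rewrite -big_split /=.
  by apply: eq_bigr => u _; rewrite -big_split; apply: eq_bigr => v _; rewrite mulrDl.
rewrite (mpolyE p) big_seq; elim/big_ind: _ => //.
  by exists (fun u v => 0); rewrite big1 // => u _; rewrite big1 // => v _; rewrite mul0r.
move=> m; rewrite mcoeff_msupp => /hp/edge_monomialsP[u [v [euv mu mv]]].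
(* The sum runs over ordered pairs, so each edge occurs twice; the whole coefficient is put on one
   orientation. *)
exists (fun u' v' => if (u' == u) && (v' == v)
  then p@_m *: 'X_[m - set_monomial [set u; v]] else 0).
rewrite (bigD1 u) //= (bigD1 v) //= !eqxx /= big1 ?addr0; last first.
  by move=> v' /andP[_ /negPf ->]; rewrite mul0r.
rewrite big1 ?addr0; last first.
  by move=> u' /negPf ->; rewrite big1 // => v' _; rewrite mul0r.
rewrite (edge_monomial (ne _ _ euv)) -scalerAl -mpolyXD submK //.
by rewrite set_monomial_le; apply/forall_inP => w /set2P[] ->.
Qed.

Definition vars_monomials (W : seq V) : pred 'X_{1..n} := fun a => has (occurs a) W.

Lemma up_orb (U U' : pred 'X_{1..n}) :
  up_closed U -> up_closed U' -> up_closed (fun a => U a || U' a).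
Proof. by move=> h h' a b /orP[/h->|/h'->]; rewrite ?orbT. Qed.

Lemma up_vars_monomials W : up_closed (vars_monomials W).
Proof.
move=> a b /hasP[w wW aw]; apply/hasP; exists w => //.
by rewrite /occurs mnmDE; rewrite /occurs in aw; lia.
Qed.

(** A new variable that [U] does not involve is regular, and in [reg_le_add] its degree 1 is
    absorbed by the homological shift. *)
Lemma reg_le_vars (U : pred 'X_{1..n}) W r : up_closed U ->
  {in W, forall w a, U (a + set_monomial [set w])%MM = U a} ->
  reg_le K U r -> reg_le K (fun a => U a || vars_monomials W a) r.
Proof.
move=> up; elim: W => [|w W IH] hW hU.
  by apply: reg_le_ext hU => a; rewrite orbF.
have {}IH : reg_le K (fun a => U a || vars_monomials W a) r.
  by apply: IH => // y yW; apply: hW; rewrite inE yW orbT.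
(* A repeated variable adds nothing to the ideal, but it would not be regular. *)
have [wW|nwW] := boolP (w \in W).
  apply: reg_le_ext IH => a; rewrite /vars_monomials /=; congr (_ || _).
  case: (boolP (occurs a w)) => //= aw; by apply/hasP; exists w.
have leE a : (set_monomial [set w] <= a)%MM = occurs a w.
  rewrite set_monomial_le; apply/forall_inP/idP => [h|aw y /set1P-> //].
  exact/h/set11.
have := reg_le_add (m := set_monomial [set w]) (t := r)
  (up_orb up (@up_vars_monomials W)) IH (s := r).
rewrite mdeg_set_monomial cards1 addn1 => h.
apply: reg_le_ext (h _ (leqnn _) (leqnn _)) => [a|].
  by rewrite /vars_monomials leE /= -orbA [_ || occurs a w]orbC.
apply: reg_le_ext IH => a /=; rewrite hW ?mem_head //; congr (_ || _).
apply: eq_in_has => y yW; rewrite occurs_add inE.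
by case: eqVneq => [yw|]; rewrite ?orbF // -yw yW in nwW *.
Qed.

(** * Edge ideals at a simplicial vertex *)

Section Simplicial.

Variables (e : rel V) (x v : V).
Hypotheses (es : ssrbool.symmetric e) (ei : irreflexive e).
Hypotheses (exv : e x v) (ex : clique_neighbours e x).

Lemma edge_monomials_delete a :
  edge_monomials e a = edge_monomials (delete_edge e x v) a
    || (set_monomial [set x; v] <= a)%MM.
Proof.
rewrite set_monomial_le; apply/edge_monomialsP/orP => [[p [q [epq ap aq]]]|[|]].
- have [e1|] := boolP (delete_edge e x v p q).
    by left; apply/edge_monomialsP; exists p, q.
  rewrite /delete_edge epq negbK => pq; right; apply/forall_inP => w.
  by case/orP: pq => /andP[/eqP pE /eqP qE]; rewrite pE qE in ap aq; case/set2P=> ->.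
- by case/edge_monomialsP=> p [q [/andP[epq _] ap aq]]; exists p, q.
- by move/forall_inP => h; exists x, v; split=> //; apply: h; [exact: set21 | exact: set22].
Qed.

(** A remaining edge meeting [x] or [v] contributes its other end, which is a neighbour of [v]
    because [x] is simplicial. Edges touching a neighbour of [v] other than [x] are multiples of
    these variables, and the others survive in [G - N[v]]. *)
Lemma edge_monomials_colon a :
  edge_monomials (delete_edge e x v) (a + set_monomial [set x; v])%MM =
  edge_monomials (delete_closed_neighbours e v) a
    || vars_monomials [seq w <- enum V | e v w && (w != x)] a.
Proof.
have var w : e v w -> w != x -> occurs a w ->
    vars_monomials [seq w <- enum V | e v w && (w != x)] a.
  by move=> evw wx aw; apply/hasP; exists w => //; rewrite mem_filter evw wx mem_enum inE.
have neq_xv : x != v by apply: contraTneq exv => ->; rewrite ei.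
apply/edge_monomialsP/orP => [[p [q [/andP[epq npq]]]]|[|]].
- rewrite !occurs_add => ap aq.
  have half y z : e y z -> ~~ ((y == x) && (z == v) || (y == v) && (z == x)) ->
      y \in [set x; v] -> occurs a z || (z \in [set x; v]) ->
      vars_monomials [seq w <- enum V | e v w && (w != x)] a.
    move=> eyz nyz /set2P[yE|yE]; rewrite yE in eyz nyz.
      rewrite eqxx (negPf neq_xv) /= orbF in nyz.
      rewrite !inE (negPf nyz) orbF => /orP[az|/eqP zx]; last by rewrite zx ei in eyz.
      apply: var az; last by apply: contraTneq eyz => ->; rewrite ei.
      by apply: ex; rewrite // eq_sym.
    rewrite eqxx [v == x]eq_sym (negPf neq_xv) /= in nyz.
    rewrite !inE (negPf nyz) /= => /orP[az|/eqP zv]; last by rewrite zv ei in eyz.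
    exact: var az.
  have [pS|pS] := boolP (p \in [set x; v]); first by right; apply: (half p q).
  have [qS|qS] := boolP (q \in [set x; v]).
    right; apply: (half q p); rewrite 1?es //.
    by rewrite orbC [_ && (p == x)]andbC [_ && (p == v)]andbC.
  rewrite (negPf pS) (negPf qS) !orbF in ap aq.
  move: pS qS; rewrite !inE !negb_or => /andP[px pv] /andP[qx qv].
  have [evp|nevp] := boolP (e v p); first by right; apply: var ap.
  have [evq|nevq] := boolP (e v q); first by right; apply: var aq.
  left; apply/edge_monomialsP; exists p, q; split=> //.
  by rewrite /delete_closed_neighbours epq (negPf pv) (negPf qv) nevp.
- case/edge_monomialsP=> p [q [/and3P[epq nvp nvq] ap aq]]; exists p, q.
  rewrite !occurs_add ap aq /delete_edge epq; split=> //=.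
  apply/negP => /orP[/andP[_ /eqP qv]|/andP[/eqP pv _]].
    by rewrite qv eqxx in nvq.
  by rewrite pv eqxx in nvp.
- case/hasP=> w; rewrite mem_filter => /andP[/andP[evw wx] _] aw.
  exists v, w; rewrite !occurs_add set22 orbT aw /delete_edge evw (negPf wx) andbF orbF.
  split=> //; apply/negP => /andP[/eqP vx _].
  by move: exv; rewrite vx ei.
Qed.

End Simplicial.

(** Induction on the number of ordered adjacent pairs; [rho] serves for both smaller graphs. *)
Lemma reg_le_edge_monomials rho e : injective rho ->
  ssrbool.symmetric e -> irreflexive e -> elimination_order rho e ->
  reg_le K (edge_monomials e) (induced_matching_number e).
Proof.
move=> rinj; have [N] := ubnP #|[set p : V * V | e p.1 p.2]|.
elim: N e => // N IH e ltN es ei eo.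
have [[x0 [y0 exy0]]|no] := classic (exists x y, e x y); last first.
  have [F [gF rF hF]] := @reg_le_pred0 K n.
  exists F; split=> // [|i k]; last by apply: leq_trans (hF i k) _; rewrite leq_add2l.
  apply: resolves_ext rF => p; split=> h m /h //.
  by case/edge_monomialsP=> u [w [euw _ _]]; case: no; exists u, w.
(* All neighbours of this [x] come after it, so the elimination order makes them a clique. *)
pose x := [arg min_(z < x0 | [exists y, e z y]) rho z].
have [{}exy xmin] : [exists y, e x y] /\ forall z y, e z y -> (rho x <= rho z)%N.
  rewrite /x; case: arg_minnP => [|z ez zmin]; first by apply/existsP; exists y0.
  by split=> // z' y ezy; apply: zmin; apply/existsP; exists y.
case/existsP: exy => v exv.
have lt y : e x y -> (rho x < rho y)%N.
  move=> exy; have eyx : e y x by rewrite es.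
  rewrite ltn_neqAle (xmin y x eyx) andbT.
  by apply: contraTneq exy => /rinj <-; rewrite ei.
have ex : clique_neighbours e x by move=> y w exy exw ne; apply: (eo x y w) => //; apply: lt.
pose e1 := delete_edge e x v; pose e2 := delete_closed_neighbours e v.
have sub (f : rel V) : (forall p q, f p q -> e p q) -> ~~ f x v ->
    (#|[set p : V * V | f p.1 p.2]| < N)%N.
  move=> fe nf; rewrite -ltnS; apply: leq_ltn_trans ltN.
  apply: proper_card; apply/properP; split.
    by apply/subsetP => p; rewrite !inE; apply: fe.
  by exists (x, v); rewrite !inE.
have h1 : reg_le K (edge_monomials e1) (induced_matching_number e).
  have : reg_le K (edge_monomials e1) (induced_matching_number e1).
    apply: IH.
    - by apply: sub => [p q /andP[]//|]; rewrite /e1 /delete_edge !eqxx /= andbF.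
    - exact: delete_edge_sym.
    - by move=> y; rewrite /e1 /delete_edge ei.
    move=> u y w /andP[euy _] /andP[euw _] yw ry rw.
    rewrite /e1 /delete_edge (eo u) //=.
    (* The pair [y], [w] is not the deleted edge: both come after [u], whereas [x] does not. *)
    have rxu := xmin u _ euy.
    apply/negP => /orP[/andP[/eqP yx _]|/andP[_ /eqP wx]].
      by rewrite yx in ry; lia.
    by rewrite wx in rw; lia.
  case=> F [gF rF hF]; exists F; split=> // i k; apply: leq_trans (hF i k) _.
  by rewrite leq_add2l induced_matching_delete_edge.
have h2 : reg_le K (edge_monomials e2) (induced_matching_number e2).
  apply: IH.
  - by apply: sub => [p q /and3P[]//|]; rewrite /e2 /delete_closed_neighbours eqxx !andbF.
  - exact: delete_closed_neighbours_sym.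
  - by move=> y; rewrite /e2 /delete_closed_neighbours ei.
  move=> u y w /and3P[euy nu ny] /and3P[euw _ nw] yw ry rw.
  by rewrite /e2 /delete_closed_neighbours (eo u) // ny.
have h2' : reg_le K (fun a => edge_monomials e1 (a + set_monomial [set x; v])%MM)
    (induced_matching_number e2).
  apply: reg_le_ext (fun a => esym (edge_monomials_colon es ei exv ex a)) _.
  apply: reg_le_vars h2 => [|w]; first exact: up_edge_monomials.
  rewrite mem_filter => /andP[/andP[evw _] _] a.
  apply/edge_monomialsP/edge_monomialsP => -[p [q [epq ap aq]]]; exists p, q; split=> //.
  - by move: ap; rewrite occurs_add => /orP[//|/set1P pw]; case/and3P: epq; rewrite pw evw orbT.
  - by move: aq; rewrite occurs_add => /orP[//|/set1P qw]; case/and3P: epq; rewrite qw evw orbT.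
  - by rewrite occurs_add ap.
  - by rewrite occurs_add aq.
apply: reg_le_ext (fun a => esym (edge_monomials_delete exv a)) _.
apply: reg_le_add h1 h2' (leqnn _) _; first exact: up_edge_monomials.
have neq_xv : x != v by apply: contraTneq exv => ->; rewrite ei.
(* The added monomial has degree 2, and the matching number drops by at least one on [e2]. *)
rewrite mdeg_set_monomial cards2 neq_xv.
by have := induced_matching_delete_closed_neighbours es ei exv ex; rewrite -/e2; lia.
Qed.

Lemma induced_matching_shift e M F : ssrbool.symmetric e -> irreflexive e ->
  induced_matching e M ->
  graded_complex F -> resolves F (mideal (K := K) (edge_monomials e)) ->
  exists k : 'I_(rk F #|M|), fr_shift k = (#|M| + #|M|)%N.
Proof.
move=> es ei /induced_matchingP[sM tM iM] gF rF.
have card2 A : A \in M -> #|A| = 2%N.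
  move=> /sM/edgesP[u [v [euv ->]]]; rewrite cards2.
  by case: eqVneq euv => // ->; rewrite ei.
have pw (s : seq {set V}) : uniq s ->
    {in s &, forall A B, A != B -> [disjoint A & B]} ->
    pairwise (@mcoprime n) (map set_monomial s).
  move=> us dis; rewrite pairwise_map; move: us; rewrite uniq_pairwise.
  apply: (sub_in_pairwise (P := mem s)) => [A B sA sB ne|]; last exact/allP.
  exact/coprime_set_monomial/dis.
have nz A : A != set0 -> set_monomial A != 0%MM.
  by rewrite -mdeg_eq0 mdeg_set_monomial cards_eq0.
have mM A : A \in enum M -> A \in M by rewrite mem_enum.
(* [ms] generates the inner ideal, and [vs], the variables of the uncovered vertices, extends it to
   the outer one. *)
pose ms := map set_monomial (enum M).
pose vs := map set_monomial (map set1 (enum (~: cover M))).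
have nz_ms : {in ms, forall m, m != 0%MM}.
  move=> _ /mapP[A AM ->]; apply: nz; rewrite -card_gt0 card2 //; exact: mM.
have co_ms : pairwise (@mcoprime n) ms.
  by apply: pw => [|A B /mM AM /mM BM]; [apply: enum_uniq | apply: tM].
have up0 : up_closed (pred0 : pred 'X_{1..n}) by [].
have [A [mA _ [k kE]]] := regular_sequence_extension (i := 0%N)
  (ord0 : 'I_(rk (trivial_complex K n) 0)) up0 (fun _ _ _ => erefl) nz_ms co_ms
  (minimal_trivial K n).
have upA : up_closed (fun a => pred0 a || has (fun m => (m <= a)%MM) ms).
  move=> a b /hasP[m mm le]; apply/hasP; exists m => //.
  exact: lepm_trans le (lem_addr _ _).
have col_vs : {in vs, forall m a, pred0 (a + m)%MM || has (fun b => (b <= a + m)%MM) ms =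
    pred0 a || has (fun b => (b <= a)%MM) ms}.
  move=> _ /mapP[_ /mapP[w wM ->] ->] a; apply: eq_in_has => _ /mapP[A' AM ->].
  apply/lem_add_coprime/coprime_set_monomial.
  rewrite disjoint_sym disjoints1; rewrite mem_enum inE in wM.
  by apply: contra wM => wA; apply/bigcupP; exists A' => //; apply: mM.
have nz_vs : {in vs, forall m, m != 0%MM}.
  move=> _ /mapP[_ /mapP[w _ ->] ->]; apply: nz; apply/set0Pn; exists w; exact: set11.
have co_vs : pairwise (@mcoprime n) vs.
  apply: pw; first by rewrite map_inj_uniq ?enum_uniq //; apply: set1_inj.
  move=> _ _ /mapP[w _ ->] /mapP[y _ ->] ne; rewrite disjoints1 inE.
  by apply: contra ne => /eqP ->.
have [B [mB eAB _]] := regular_sequence_extension k upA col_vs nz_vs co_vs mA.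
have upB : up_closed (fun a => (pred0 a || has (fun m => (m <= a)%MM) ms)
    || has (fun m => (m <= a)%MM) vs).
  apply: up_orb => // a b /hasP[m mm le]; apply/hasP; exists m => //.
  exact: lepm_trans le (lem_addr _ _).
(* Edges of [M] are edges of the graph, giving the inner inclusion; an edge with both ends covered
   belongs to [M], giving the outer one. *)
have [p hp m /hp/hasP[_ /mapP[A' AM ->]]|p hp m /hp/edge_monomialsP[u [v [euv mu mv]]]|l lE] :=
  embedded_shift (graded_mideal K (@up_edge_monomials e)) (graded_mideal K upB)
    _ _ mA gF rF mB eAB k.
- have /edgesP[u [v [euv ->]]] := sM _ (mM _ AM).
  rewrite set_monomial_le => /forall_inP h; apply/edge_monomialsP.
  by exists u, v; split=> //; apply: h; [exact: set21 | exact: set22].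
- have var w : occurs m w -> w \notin cover M -> has (fun a => (a <= m)%MM) vs.
    move=> mw nw; apply/hasP; exists (set_monomial [set w]).
      by rewrite !map_f // mem_enum inE.
    by rewrite set_monomial_le; apply/forall_inP => y /set1P ->.
  have [uM|/(var u mu)->] := boolP (u \in cover M); last by rewrite orbT.
  have [vM|/(var v mv)->] := boolP (v \in cover M); last by rewrite orbT.
  rewrite /=; apply/orP; left; apply/hasP; exists (set_monomial [set u; v]).
    by rewrite map_f // mem_enum iM.
  by rewrite set_monomial_le; apply/forall_inP => y /set2P[] ->.
have sumE : \sum_(m <- ms) mdeg m = (#|M| + #|M|)%N.
  rewrite big_map big_enum /= (eq_bigr (fun=> 2%N)) ?sum_nat_const ?muln2 ?addnn //.
  by move=> A' /card2 <-; rewrite mdeg_set_monomial.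
rewrite kE sumE /= add0n in lE; move: l lE.
by rewrite size_map -cardE addn0 => l lE; exists l.
Qed.

Lemma regularity_elimination_order rho e : injective rho ->
  ssrbool.symmetric e -> irreflexive e -> elimination_order rho e ->
  regularity_quotient_is (edge_ideal K e) (Posz (induced_matching_number e)).
Proof.
move=> rinj es ei eo; have hI := graded_mideal K (@up_edge_monomials e).
have eI := edge_idealE ei.
have [G [gG rG hG]] := reg_le_edge_monomials rinj es ei eo.
split.
  have [|F [gF rF mF]] := exists_minimal_resolution hI.
    move=> p hp; apply/eqP; apply: contraT => /hp/edge_monomialsP[u [v [_]]].
    by rewrite /occurs mnm0E.
  by exists F; split=> //; apply: resolves_ext rF => p; rewrite eI.
move=> F [gF rF mF]; have {}rF : resolves F (mideal (edge_monomials e)).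
  by apply: resolves_ext rF.
have bettiE i j : betti F i j != 0%N -> exists k : 'I_(rk F i), fr_shift k = j.
  by rewrite -lt0n card_gt0 => /set0Pn[k]; rewrite inE => /eqP; exists k.
split=> [|i j /bettiE[k <-]]; last first.
  have [l <-] := minimal_shift hI (And3 gF rF mF) gG rG k.
  by have := hG _ l; lia.
have [M iM ->] : exists2 M, induced_matching e M & induced_matching_number e = #|M|.
  have [|M iM eM] := @eq_bigmax_cond _ [pred M | induced_matching e M] (fun M => #|M|).
    by apply/card_gt0P; exists set0; apply: induced_matching0.
  by exists M.
have [k kE] := induced_matching_shift es ei iM gF rF.
exists #|M|, (#|M| + #|M|)%N; split; last by lia.
by rewrite -lt0n card_gt0; apply/set0Pn; exists k; rewrite inE kE.
Qed.

End EdgeIdeals.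

(** * Brush polyominoes *)

Section Polyominoes.

Implicit Types (P I J : {fset cell}) (a b c : cell).

(* [d = true] for rows, [d = false] for columns; [coord d c] puts the coordinate
   which varies along the run first. *)
Definition run (d : bool) := if d then row_run else col_run.

Definition coord (d : bool) c : cell := if d then c else (c.2, c.1).

Lemma mem_run d a k c : (c \in run d a k) =
  [&& (coord d c).2 == (coord d a).2, (coord d a).1 <= (coord d c).1
    & (coord d c).1 < (coord d a).1 + k%:Z].
Proof.
case: d a c => -[x y] [x' y']; apply/imfsetP/and3P => /= [[t]|[]].
- by rewrite mem_iota => /andP[_ lt] [-> ->]; split; lia.
- move=> /eqP -> le lt; exists `|x' - x|%N; first by rewrite mem_iota; lia.
  by congr (_, _); lia.
- by rewrite mem_iota => /andP[_ lt] [-> ->]; split; lia.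
- move=> /eqP -> le lt; exists `|y' - y|%N; first by rewrite mem_iota; lia.
  by congr (_, _); lia.
Qed.

Lemma card_run d a k : #|` run d a k| = k.
Proof.
case: d; rewrite card_imfset /= ?undup_id ?size_iota ?iota_uniq // => i j []; lia.
Qed.

(** The union starts at one of the two given cells, which ensures below that its first cell lies in
    [P]. *)
Lemma run_union d a k b l c : c \in run d a k -> c \in run d b l ->
  exists e m, (e = a \/ e = b) /\ (run d a k `|` run d b l)%fset = run d e m.
Proof.
rewrite !mem_run => /and3P[/eqP ca ac1 ac2] /and3P[/eqP cb bc1 bc2].
pose lo := Num.min (coord d a).1 (coord d b).1.
pose hi := Num.max ((coord d a).1 + k%:Z) ((coord d b).1 + l%:Z).
pose e := if (coord d a).1 <= (coord d b).1 then a else b.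
exists e, `|hi - lo|%N; split; first by rewrite /e; case: ifP; [left | right].
have e1 : (coord d e).1 = lo by rewrite /e /lo; case: ifP; lia.
have e2 : (coord d e).2 = (coord d c).2 by rewrite /e; case: ifP.
apply/fsetP => x; rewrite in_fsetU !mem_run e1 e2 ca -ca cb /lo /hi.
by case: eqP => //= _; lia.
Qed.

Lemma cell_intervalP P I : reflect
  [/\ (I `<=` P)%fset, (2 <= #|` I|)%N
    & exists d a, a \in P /\ I = run d a #|` I|]
  (cell_interval P I).
Proof.
apply: (iffP and3P) => -[sIP I2].
  by case/existsP=> a /orP[]/eqP IE; split=> //; [exists true | exists false];
    exists (val a); split=> //; apply: valP.
move=> [d [a [aP IE]]]; split=> //; apply/existsP; exists [` aP]%fset.
by case: d IE => /= <-; rewrite eqxx ?orbT.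
Qed.

Lemma max_cell_intervalsP P I : reflect
  (cell_interval P I /\ forall J, cell_interval P J -> (I `<=` J)%fset -> J = I)
  (I \in max_cell_intervals P).
Proof.
rewrite !inE /= fpowersetE; apply: (iffP and3P) => [[_ ci /allP h]|[ci h]]; split=> //.
- move=> J cJ IJ; have := h J; rewrite fpowersetE; case/cell_intervalP: (cJ) => -> _ _.
  by rewrite cJ IJ => /(_ isT)/eqP.
- by case/cell_intervalP: ci.
- by apply/allP => J _; apply/implyP => /andP[cJ IJ]; apply/eqP/h.
Qed.

(** The union of the two overlapping runs is again a cell interval, so maximality makes both equal
    to it. *)
Lemma max_cell_intervals_parallel P I J d a b k l c :
  I \in max_cell_intervals P -> J \in max_cell_intervals P ->
  I = run d a k -> J = run d b l -> a \in P -> b \in P ->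
  c \in I -> c \in J -> I = J.
Proof.
move=> /max_cell_intervalsP[/cell_intervalP[sI I2 _] mI].
move=> /max_cell_intervalsP[/cell_intervalP[sJ _ _] mJ].
move=> IE JE aP bP cI cJ; rewrite IE in cI; rewrite JE in cJ.
have [e [m [eab UE]]] := run_union cI cJ; rewrite -IE -JE in UE.
have cU : cell_interval P (I `|` J)%fset.
  apply/cell_intervalP; split; first by rewrite fsubUset sI.
    exact: leq_trans I2 (fsubset_leq_card (fsubsetUl _ _)).
  exists d, e; split; first by case: eab => ->.
  by rewrite UE card_run.
by rewrite -[LHS](mI _ cU (fsubsetUl _ _)) (mJ _ cU (fsubsetUr _ _)).
Qed.

(** A maximal interval parallel to [J] equals [J], as it meets [J]. So every interval through [c] is
    perpendicular to [J], and two of them are parallel and share [c]. *)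
Lemma brush_single_interval P J (Is : seq {fset cell}) :
  max_cell_intervals P = [fset I in J :: Is]%fset ->
  (forall I, I \in Is -> (I `&` J != fset0)%fset) ->
  forall I I' c, I \in max_cell_intervals P -> I' \in max_cell_intervals P ->
    c \in I -> c \in I' -> c \notin J -> I = I'.
Proof.
move=> CE meetJ I I' c IC I'C cI cI' cJ.
have JC : J \in max_cell_intervals P by rewrite CE !inE eqxx.
have dirP I0 : I0 \in max_cell_intervals P -> exists d a, a \in P /\ I0 = run d a #|` I0|.
  by case/max_cell_intervalsP => /cell_intervalP[].
have [d [a [aP JE]]] := dirP J JC.
have crossing I0 : I0 \in max_cell_intervals P -> c \in I0 ->
    exists b, b \in P /\ I0 = run (~~ d) b #|` I0|.
  move=> I0C cI0; have [d' [b [bP I0E]]] := dirP _ I0C.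
  have [dd'|dd'] := eqVneq d' d; last first.
    have d'E : d' = ~~ d by move: dd'; case: (d'); case: (d).
    by exists b; rewrite -d'E.
  rewrite dd' in I0E; case/negP: cJ; suff <- : I0 = J by [].
  have : I0 \in [fset I in J :: Is]%fset by rewrite -CE.
  rewrite !inE => /predU1P[//|/meetJ/fset0Pn[z]]; rewrite in_fsetI => /andP[zI zJ].
  exact: max_cell_intervals_parallel I0C JC I0E JE bP aP zI zJ.
have [b [bP IE]] := crossing _ IC cI.
have [b' [b'P I'E]] := crossing _ I'C cI'.
exact: max_cell_intervals_parallel IC I'C IE I'E bP b'P cI cI'.
Qed.

(** * The attacking graph and its elimination order *)

Lemma attackingP P (u v : P) : reflect
  (u != v /\ exists I, [/\ I \in max_cell_intervals P, val u \in I & val v \in I])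
  (attacking P u v).
Proof.
apply: (iffP andP) => [[uv /hasP[I IC /andP[uI vI]]]|[uv [I [IC uI vI]]]].
  by split=> //; exists I.
by split=> //; apply/hasP; exists I; rewrite ?uI.
Qed.

Lemma attacking_sym P : ssrbool.symmetric (attacking P).
Proof.
move=> u v; apply/attackingP/attackingP => -[uv [I [IC uI vI]]].
  by rewrite eq_sym; split=> //; exists I.
by rewrite eq_sym; split=> //; exists I.
Qed.

Lemma attacking_irr P : irreflexive (attacking P).
Proof. by move=> u; rewrite /attacking eqxx. Qed.

(** Ranks are smaller than the number of cells, so this offset puts all cells of [J] last and keeps
    the values distinct. *)
Definition outside_first P J (u : P) : nat :=
  ((val u \in J) * #|{: P}| + enum_rank u)%N.

Lemma outside_first_inj P J : injective (@outside_first P J).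
Proof.
move=> u v; rewrite /outside_first => e; apply: enum_rank_inj; apply: val_inj.
have arith (b c : bool) N i j : (b * N + i = c * N + j -> i < N -> j < N -> i = j)%N.
  by case: b; case: c; rewrite ?mul1n ?mul0n; lia.
exact: arith e (ltn_ord (enum_rank u)) (ltn_ord (enum_rank v)).
Qed.

(** The cells after a cell of [J] all lie in [J]; the neighbours of a cell outside [J] all lie in
    its only maximal interval. *)
Lemma brush_elimination_order P J (Is : seq {fset cell}) :
  max_cell_intervals P = [fset I in J :: Is]%fset ->
  (forall I, I \in Is -> (I `&` J != fset0)%fset) ->
  elimination_order (@outside_first P J) (attacking P).
Proof.
move=> CE meetJ u v w /attackingP[_ [I [IC uI vI]]] /attackingP[_ [I' [I'C uI' wI']]] vw.
have [uJ ruv ruw|uJ _ _] := boolP (val u \in J).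
  have arith (b : bool) N i j : (1 * N + i < b * N + j -> j < N -> b)%N.
    by case: b; rewrite ?mul1n ?mul0n; lia.
  have above (x : P) : (outside_first J u < outside_first J x)%N -> val x \in J.
    by rewrite /outside_first uJ => /arith; apply; apply: ltn_ord.
  apply/attackingP; split=> //; exists J; split; try exact: above.
  by rewrite CE !inE eqxx.
have II' := brush_single_interval CE meetJ IC I'C uI uI' uJ.
by apply/attackingP; split=> //; exists I; split=> //; rewrite II'.
Qed.

End Polyominoes.

Theorem corollary5p7 (K : fieldType) (P : {fset cell}) (hP : pure_brush P) :
  regularity_quotient_is (edge_ideal K (attacking P))
    (Posz (induced_matching_number (attacking P))).
Proof.
case: hP => -[_ _ _ [J [Is [_ CE _ meetJ]]]] _.
apply: (regularity_elimination_order K (@outside_first_inj P J)).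
- exact: attacking_sym.
- exact: attacking_irr.
- exact: brush_elimination_order CE meetJ.
Qed.
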